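(* Every Knuth equivalence class in $A_n^\dagger$ contains a unique timed tableau.
   Context: Let $A_n=\{1,\dots,n\}$ with its usual order. A timed word of length $r\ge 0$ in $A_n$ is a right-continuous piecewise-constant function $w:[0,r)\to A_n$ with finitely many discontinuities; $l(w)=r$. $A_n^\dagger$ is the monoid of timed words under concatenation. A timed row is a weakly increasing timed word. Every timed word has a unique row decomposition $w=u_l\cdots u_1$ into timed rows with $u_iu_{i-1}$ never a row. For timed rows, $u\lhd v$ means $l(u)\ge l(v)$ and $u(t)<v(t)$ for $0\le t<l(v)$. A timed tableau is a timed word whose row decomposition $u_l\cdots u_1$ satisfies $u_1\lhd\cdots\lhd u_l$. Timed Knuth relations: for timed rows $x,y,z$ such that $xyz$ is a timed row, $(\kappa_1)$: $xzy\equiv zxy$ if $l(z)=l(y)$ and $\lim_{t\to l(y)^-}y(t)<z(0)$; $(\kappa_2)$: $yxz\equiv yzx$ if $l(x)=l(y)$ and $\lim_{t\to l(x)^-}x(t)<y(0)$. Knuth equivalence on $A_n^\dagger$ is the equivalence relation generated by $pv_1q\equiv pv_2q$ for all timed words $p,q$ and all pairs $v_1,v_2$ forming the two sides of a timed Knuth relation. *)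

(* Defs.v *)
From HB Require Import structures.
From Stdlib Require Import Relations.
From mathcomp Require Import all_boot all_order all_algebra.
From mathcomp Require Import boolp classical_sets reals topology normedtype.

Set Implicit Arguments.
Unset Strict Implicit.
Unset Printing Implicit Defensive.

Import Order.TTheory GRing.Theory Num.Theory.
Import numFieldNormedType.Exports.

Local Open Scope classical_set_scope.
Local Open Scope ring_scope.

(* The ordered alphabet {1, ..., n} is represented by 'I_n = {0, ..., n-1}.
   A function [0,r) -> 'I_n is represented by a function R -> option 'I_n whose
   value is [None] exactly outside [0,r), so that two timed words are Leibniz
   equal iff they have the same length and agree on [0,r).
   As the alphabet is discrete, a limit is an eventually constant value. *)
Section TimedFun.
Variables (R : realType) (n : nat).
Implicit Types (r : R) (f : R -> option 'I_n).

Definition defined_on r f := forall t, isSome (f t) = (0 <= t < r).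

Definition right_continuous r f :=
  forall t, 0 <= t < r -> \forall s \near t^'+, f s = f t.

(* [f] is constant on every subinterval of [0,r) that avoids the finite set of
   breakpoints [D]; hence all its discontinuities lie in [D]. *)
Definition piecewise_constant r f :=
  exists D : seq R, forall s t, 0 <= s -> s <= t -> t < r ->
    (forall d, d \in D -> ~~ (s <= d <= t)) -> f s = f t.

End TimedFun.

Record timed_word (R : realType) (n : nat) := TimedWord {
  tlen : R;
  tfun :> R -> option 'I_n;
  tlen_ge0 : 0 <= tlen;
  tfun_def : defined_on tlen tfun;
  tfun_rc : right_continuous tlen tfun;
  tfun_pc : piecewise_constant tlen tfun }.

Arguments TimedWord {R n} tlen tfun.

Section Monoid.
Variables (R : realType) (n : nat).
Implicit Types (u v w : timed_word R n).

Lemma timed_wordP u v : tlen u = tlen v -> (forall t, u t = v t) -> u = v.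
Proof.
case: u v => [r f a b c d] [r' f' a' b' c' d'] /= rE /funext fE.
move: a b c d; rewrite rE fE => a b c d.
by congr TimedWord; exact: Prop_irrelevance.
Qed.

Lemma tfun_None u t : (0 <= t < tlen u) = false -> u t = None.
Proof. by rewrite -tfun_def; case: (u t). Qed.

Definition tempty_fun (t : R) : option 'I_n := None.

Fact tempty_def : defined_on 0 tempty_fun.
Proof. by move=> t /=; case: leP => //= t0; rewrite ltNge t0. Qed.

Fact tempty_rc : right_continuous 0 tempty_fun.
Proof. by move=> t /andP[t0]; rewrite ltNge t0. Qed.

Fact tempty_pc : piecewise_constant 0 tempty_fun.
Proof. by exists [::]. Qed.

Definition tempty : timed_word R n :=
  TimedWord 0 tempty_fun (lexx 0) tempty_def tempty_rc tempty_pc.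

Definition tcat_fun u v (t : R) : option 'I_n :=
  if t < tlen u then u t else v (t - tlen u).

Fact tcat_ge0 u v : 0 <= tlen u + tlen v.
Proof. by rewrite addr_ge0 // tlen_ge0. Qed.

Fact tcat_def u v : defined_on (tlen u + tlen v) (tcat_fun u v).
Proof.
move=> t; rewrite /tcat_fun; case: ltP => tu; rewrite tfun_def.
  by rewrite tu (lt_le_trans tu) // lerDl tlen_ge0.
by rewrite subr_ge0 tu ltrBlDl (le_trans (tlen_ge0 u) tu).
Qed.

Fact tcat_rc u v : right_continuous (tlen u + tlen v) (tcat_fun u v).
Proof.
move=> t /andP[t0 tuv]; rewrite /tcat_fun; case: ltP => tu.
  have := @tfun_rc _ _ u t; rewrite t0 tu => /(_ isT) H.
  near=> s; have -> : s < tlen u by near: s; exact: nbhs_right_lt.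
  by near: s.
have := @tfun_rc _ _ v (t - tlen u).
rewrite subr_ge0 tu ltrBlDl tuv => /(_ isT) H.
have {}H : \forall s \near t^'+, v (s - tlen u) = v (t - tlen u).
  move/nbhs_right0P : H => H; apply/nbhs_right0P; near=> e.
  by rewrite addrAC; near: e.
near=> s; have -> : (s < tlen u) = false.
  by apply/negbTE; rewrite -leNgt (le_trans tu) //; near: s;
     exact: nbhs_right_ge.
by near: s.
Unshelve. all: by end_near. Qed.

Fact tcat_pc u v : piecewise_constant (tlen u + tlen v) (tcat_fun u v).
Proof.
have [Du Hu] := tfun_pc u; have [Dv Hv] := tfun_pc v.
exists (tlen u :: Du ++ map (+%R (tlen u)) Dv) => s t s0 st tuv DP.
rewrite /tcat_fun; case: (ltP t (tlen u)) => tu.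
  rewrite (le_lt_trans st tu); apply: Hu => // d dD.
  by apply: DP; rewrite inE mem_cat dD orbT.
have us : tlen u < s.
  by rewrite ltNge; apply: contraT => /negPn su;
     have := DP _ (mem_head _ _); rewrite su tu.
rewrite ltNge (ltW us) /=; apply: Hv; rewrite ?subr_ge0 ?(ltW us) ?lerB //.
  by rewrite ltrBlDl.
move=> d dD; rewrite lerBlDl lerBrDl; apply: DP.
by rewrite inE mem_cat (map_f _ dD) !orbT.
Qed.

Definition tcat u v : timed_word R n :=
  TimedWord (tlen u + tlen v) (tcat_fun u v) (tcat_ge0 u v) (tcat_def u v)
    (@tcat_rc u v) (tcat_pc u v).

Lemma tcatA : associative tcat.
Proof.
move=> u v w; apply: timed_wordP => [|t] /=; first by rewrite addrA.
rewrite /tcat_fun /= /tcat_fun ltrBlDl opprD addrA.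
case: ltP => [tu|//]; rewrite (lt_le_trans tu) //.
by rewrite lerDl tlen_ge0.
Qed.

Lemma tcat0w : left_id tempty tcat.
Proof.
move=> u; apply: timed_wordP => [|t] /=; rewrite ?add0r // /tcat_fun /= subr0.
by case: ltP => // t0; rewrite tfun_None // leNgt t0.
Qed.

Lemma tcatw0 : right_id tempty tcat.
Proof.
move=> u; apply: timed_wordP => [|t] /=; rewrite ?addr0 // /tcat_fun.
by case: ltP => // ut; rewrite (@tfun_None u) // ltNge ut andbF.
Qed.

HB.instance Definition _ :=
  Monoid.isLaw.Build (timed_word R n) tempty tcat tcatA tcat0w tcatw0.

End Monoid.

Arguments tempty {R n}.

Section Tableaux.
Variables (R : realType) (n : nat).
Implicit Types (u v w x y z p q : timed_word R n) (us : seq (timed_word R n)).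

Definition timed_row w :=
  forall s t (a b : 'I_n), s <= t -> w s = Some a -> w t = Some b -> (a <= b)%N.

(* [us] lists the rows in the order in which they are read in [w]: with
   us = [:: u_l; ...; u_1], w = u_l ... u_1.  Positivity of the lengths only
   rules out [:: tempty], and makes the decomposition of [tempty] (namely
   [::]) unique as well. *)
Definition row_decomposition w us :=
  [/\ w = \big[@tcat R n/tempty]_(u <- us) u,
      forall i, (i < size us)%N ->
        timed_row (nth tempty us i) /\ 0 < tlen (nth tempty us i)
    & forall i, (i.+1 < size us)%N ->
        ~ timed_row (tcat (nth tempty us i) (nth tempty us i.+1))].

Definition row_lt u v :=
  tlen v <= tlen u /\
  forall t (a b : 'I_n), 0 <= t < tlen v ->
    u t = Some a -> v t = Some b -> (a < b)%N.

Definition timed_tableau w :=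
  exists us, row_decomposition w us /\
    forall i, (i.+1 < size us)%N ->
      row_lt (nth tempty us i.+1) (nth tempty us i).

(* The left limit of [u] at its right end exists and is smaller than the first
   letter of [v]; in particular [u] and [v] are nonempty. *)
Definition last_lt_first u v :=
  exists a b : 'I_n, [/\ \forall t \near (tlen u)^'-, u t = Some a,
    v 0 = Some b & (a < b)%N].

Inductive timed_knuth : timed_word R n -> timed_word R n -> Prop :=
| Kappa1 x y z of timed_row x & timed_row y & timed_row z
    & timed_row (tcat (tcat x y) z)
    & tlen z = tlen y & last_lt_first y z :
    timed_knuth (tcat (tcat x z) y) (tcat (tcat z x) y)
| Kappa2 x y z of timed_row x & timed_row y & timed_row z
    & timed_row (tcat (tcat x y) z)
    & tlen x = tlen y & last_lt_first x y :
    timed_knuth (tcat (tcat y x) z) (tcat (tcat y z) x).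

Inductive knuth_step : timed_word R n -> timed_word R n -> Prop :=
| KnuthStep p v1 v2 q of timed_knuth v1 v2 :
    knuth_step (tcat (tcat p v1) q) (tcat (tcat p v2) q).

Definition knuth_equiv := clos_refl_sym_trans (timed_word R n) knuth_step.

Definition knuth_class w : set (timed_word R n) := [set v | knuth_equiv w v].

End Tableaux.

(* Main.v *)
Require Import Defs.
From HB Require Import structures.
From Stdlib Require Import Relations.
From mathcomp Require Import all_boot all_order all_algebra.
From mathcomp Require Import boolp classical_sets reals topology normedtype.
From mathcomp Require Import zify lra.

(* Existence.  Timed row insertion: a run of a letter c inserted into a row is
   cut into pieces, each of which bumps a run of the same duration of a single
   larger letter into the row above; writing U(a) for the time spent by a row
   in letters < a, the condition "row U lies under row V" is V(a+1) <= U(a) and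
   is seen to be preserved.

   Uniqueness.  In the spirit of Greene's theorem and of the tropical
   representations of plactic monoids, let a "chain" over a word assign to each
   run an infinite strictly increasing sequence S of integers (the positions of
   "strands"), weakly increasing in time; a run of c of duration t contributes t
   if c is the position of some strand.  The possible total gains of chains
   between prescribed endpoints P and Q behave multiplicatively under
   concatenation and are invariant under the Knuth relations.  For a tableau,
   cut along a common grid into cells, the maximal gain with k active strands
   moving from (0, ..., k-1) to (a-k, ..., a-1) is the time spent in letters < a
   in the first k rows: strand i can follow row i, and conversely a strand hits
   each column, which is read in decreasing order, at most once.  These numbers
   determine the tableau. *)

Set Implicit Arguments.
Unset Strict Implicit.
Unset Printing Implicit Defensive.

Import Order.TTheory GRing.Theory Num.Theory.
Import numFieldNormedType.Exports.

Local Open Scope classical_set_scope.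
Local Open Scope ring_scope.

(** * Runs and common grids *)

Section Words.
Variables (R : realType) (n : nat).
Implicit Types (u v w : timed_word R n) (s : seq (nat * R)).

Definition nrun_fun (a : nat) (t x : R) : option 'I_n :=
  if 0 <= x < t then insub a else None.

Definition nrun_len (a : nat) (t : R) : R :=
  if (a < n)%N then Num.max 0 t else 0.

Fact nrun_ge0 a t : 0 <= nrun_len a t.
Proof. by rewrite /nrun_len; case: ifP => // _; rewrite le_max lexx. Qed.

Fact nrun_def a t : defined_on (nrun_len a t) (nrun_fun a t).
Proof.
move=> x; rewrite /nrun_fun /nrun_len; case: (ltnP a n) => an.
  rewrite insubT /= lt_max; case: (leP 0 x) => //= x0.
  by case: ltP.
by rewrite insubF ?ltnNge ?an //= if_same; case: ltgtP.
Qed.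

Fact nrun_const a t x y :
  0 <= x < nrun_len a t -> 0 <= y < nrun_len a t ->
  nrun_fun a t x = nrun_fun a t y.
Proof.
rewrite /nrun_len /nrun_fun; case: (ltnP a n) => an.
  by move=> /andP[x0 xt] /andP[y0 yt]; move: xt yt;
     rewrite !lt_max ![_ < 0]ltNge x0 y0 /= => -> ->.
by move=> /andP[x0]; rewrite ltNge x0.
Qed.

Fact nrun_rc a t : right_continuous (nrun_len a t) (nrun_fun a t).
Proof.
move=> x xl; have /andP[x0 xt] := xl; near=> y; apply: nrun_const => //.
apply/andP; split; last by near: y; exact: nbhs_right_lt.
by apply: (le_trans x0); near: y; exact: nbhs_right_ge.
Unshelve. all: by end_near. Qed.

Fact nrun_pc a t : piecewise_constant (nrun_len a t) (nrun_fun a t).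
Proof.
exists [::] => x y x0 xy yt _; apply: nrun_const.
  by rewrite x0 (le_lt_trans xy).
by rewrite (le_trans x0 xy).
Qed.

(* The letter [a] held for the duration [t]; it is empty if [a >= n] or
   [t <= 0]. *)
Definition nrun a t : timed_word R n :=
  TimedWord (nrun_len a t) (nrun_fun a t) (nrun_ge0 a t) (@nrun_def a t)
    (@nrun_rc a t) (nrun_pc a t).

Definition ev s : timed_word R n :=
  \big[@tcat R n/tempty]_(x <- s) nrun x.1 x.2.

Lemma ev_nil : ev [::] = tempty. Proof. exact: big_nil. Qed.

Lemma ev_cons x s : ev (x :: s) = tcat (nrun x.1 x.2) (ev s).
Proof. exact: big_cons. Qed.

Lemma ev_cat s s' : ev (s ++ s') = tcat (ev s) (ev s').
Proof. exact: big_cat. Qed.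

Lemma ev_seq1 x : ev [:: x] = nrun x.1 x.2.
Proof. by rewrite ev_cons ev_nil tcatw0. Qed.

Lemma tlen0 w : tlen w = 0 -> w = tempty.
Proof.
move=> w0; apply: timed_wordP => // t.
by rewrite tfun_None // w0; case: leP => //= t0; rewrite ltNge t0.
Qed.

Lemma tlen_nrun a t : (a < n)%N -> 0 <= t -> tlen (nrun a t) = t.
Proof. by move=> an t0 /=; rewrite /nrun_len an; apply/max_idPr. Qed.

Lemma nrun_out a t : (n <= a)%N -> nrun a t = tempty.
Proof. by move=> an; apply: tlen0; rewrite /= /nrun_len ltnNge an. Qed.

Lemma nrun0 a : nrun a 0 = tempty.
Proof. by apply: tlen0; rewrite /= /nrun_len maxxx if_same. Qed.

Lemma nrunE a t x : nrun a t x = if 0 <= x < t then insub a else None.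
Proof. by []. Qed.

Lemma nrunD a x y : 0 <= x -> 0 <= y ->
  tcat (nrun a x) (nrun a y) = nrun a (x + y).
Proof.
move=> x0 y0; case: (ltnP a n) => an; last by rewrite !nrun_out // tcatw0.
apply: timed_wordP => [|t].
  change (tlen (nrun a x) + tlen (nrun a y) = tlen (nrun a (x + y))).
  by rewrite !tlen_nrun ?addr_ge0.
rewrite [LHS]/= /tcat_fun (tlen_nrun an x0) !nrunE.
case: (ltP t x) => tx.
  by rewrite andbT; case: (leP 0 t) => //= t0; rewrite (lt_le_trans tx) ?lerDl.
by rewrite subr_ge0 tx (le_trans x0 tx) ltrBlDl addrC.
Qed.

Lemma tcat_inj u v v' : tcat u v = tcat u v' -> v = v'.
Proof.
move=> E; have /= := congr1 (@tlen R n) E; move/addrI => lE.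
apply: timed_wordP => // t; case: (ltP t 0) => t0.
  by rewrite !tfun_None // [0 <= t]leNgt t0.
have /= := congr1 (fun w : timed_word R n => w (t + tlen u)) E.
by rewrite /tcat_fun ltNge lerDr t0 /= addrK.
Qed.

Lemma tcat_Some u v t c : tcat u v t = Some c ->
  (t < tlen u /\ u t = Some c) \/ (tlen u <= t /\ v (t - tlen u) = Some c).
Proof. by rewrite /= /tcat_fun; case: ltP => tu H; [left|right]. Qed.

Lemma timed_row_cat u v : timed_row u -> timed_row v ->
  (forall x y (a b : 'I_n), u x = Some a -> v y = Some b -> (a <= b)%N) ->
  timed_row (tcat u v).
Proof.
move=> ru rv uv x y a b xy /tcat_Some[[xu ua]|[xu va]] /tcat_Some[[yu ub]|[yu vb]].
- exact: ru ua ub.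
- exact: uv ua vb.
- by have := le_lt_trans (le_trans xu xy) yu; rewrite ltxx.
- by apply: rv va vb; rewrite lerB.
Qed.

Lemma tcat_r u v x : 0 <= x -> tcat u v (tlen u + x) = v x.
Proof. by move=> x0; rewrite /= /tcat_fun ltNge lerDl x0 /= addrC addKr. Qed.

Lemma tcat_l u v x (a : 'I_n) : u x = Some a -> tcat u v x = Some a.
Proof.
move=> ua; rewrite /= /tcat_fun; have : isSome (u x) by rewrite ua.
by rewrite tfun_def => /andP[_ ->].
Qed.

Lemma tfun_Some w x (a : 'I_n) : w x = Some a -> 0 <= x < tlen w.
Proof. by move=> wa; rewrite -tfun_def wa. Qed.

Lemma timed_row_catP u v x y (a b : 'I_n) : timed_row (tcat u v) ->
  u x = Some a -> v y = Some b -> (a <= b)%N.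
Proof.
move=> r ua vb; have /andP[_ xu] := tfun_Some ua.
have /andP[y0 yv] := tfun_Some vb.
apply: (r x (tlen u + y)); first by rewrite (le_trans (ltW xu)) // lerDl.
- exact: tcat_l.
- by rewrite tcat_r.
Qed.

Lemma timed_row_nrun a t : timed_row (nrun a t).
Proof.
move=> x y b c _; rewrite !nrunE; case: ifP => // _ E.
by case: ifP => // _; rewrite E => -[->].
Qed.

Lemma nrun_letter a t x (b : 'I_n) : nrun a t x = Some b -> a = b.
Proof. by rewrite nrunE; case: ifP => // _; case: insubP => //= c _ <- [->]. Qed.

Lemma ev_letter s x (b : 'I_n) : ev s x = Some b -> (b : nat) \in map fst s.
Proof.
elim: s x => [|[a t] s IH] x; first by rewrite ev_nil.
rewrite ev_cons => /tcat_Some[[_ /nrun_letter /= <-]|[_ /IH bs]].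
  by rewrite inE eqxx.
by rewrite inE bs orbT.
Qed.

Lemma ev_row s : sorted leq (map fst s) -> timed_row (ev s).
Proof.
elim: s => [|[a t] s IH] /=; first by move=> _ x y b c; rewrite ev_nil.
rewrite path_sortedE; last exact: leq_trans.
move=> /andP[/allP as_ /IH rs]; rewrite ev_cons; apply: timed_row_cat => //.
  exact: timed_row_nrun.
by move=> x y b c /nrun_letter ab /ev_letter; rewrite -ab; exact: as_.
Qed.

(** The value [n] codes a time outside the word: it exceeds every letter, and a run of [n] is
    empty. *)
Definition ent w x : nat := if w x is Some c then nat_of_ord c else n.

Lemma ent_lt w x : (ent w x < n)%N = (0 <= x < tlen w).
Proof. by rewrite -tfun_def /ent; case: (w x) => [c|] /=; rewrite ?ltnn ?ltn_ord. Qed.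

Lemma ent_Some w x (c : 'I_n) : w x = Some c -> ent w x = c.
Proof. by rewrite /ent => ->. Qed.

Lemma iotaSr i m : iota i m.+1 = rcons (iota i m) (i + m)%N.
Proof. by rewrite -addn1 iotaD cats1. Qed.

Definition glist w (d : nat -> R) m : seq (nat * R) :=
  [seq (ent w (d p), d p.+1 - d p) | p <- iota 0 m].

(** By induction on [q], the first [q] cells evaluate to [w] cut off at time [d q]; a cell past the
    end of [w] carries [n] and evaluates to the empty word. *)
Lemma ev_glist w (d : nat -> R) m : d 0%N = 0 ->
    (forall p, (p < m)%N -> d p < d p.+1) ->
    (forall p x, (p < m)%N -> d p <= x < d p.+1 -> w x = w (d p)) ->
    tlen w <= d m ->
  w = ev (glist w d m).
Proof.
move=> d0 dS dc wm.
have d_ge0 q : (q <= m)%N -> 0 <= d q.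
  elim: q => [|q IH] qm; first by rewrite d0.
  by rewrite (le_trans (IH (ltnW qm))) // ltW // dS.
have : forall q, (q <= m)%N -> tlen (ev (glist w d q)) = Num.min (tlen w) (d q)
    /\ forall x, ev (glist w d q) x = if x < d q then w x else None.
  elim=> [|q IH] qm.
    rewrite ev_nil d0; split=> [|x]; first by apply/esym/min_idPr/tlen_ge0.
    by case: (ltP x 0) => // x0; rewrite [RHS]tfun_None // [0 <= x]leNgt x0.
  have [lq fq] := IH (ltnW qm).
  rewrite /glist iotaSr add0n map_rcons -cats1 ev_cat ev_seq1 /=.
  rewrite -/(glist w d q); have dq0 := d_ge0 _ (ltnW qm); have dq := dS _ qm.
  case wq: (w (d q)) => [c|].
    have /andP[_ dw] := tfun_Some wq.
    have dw' : d q.+1 <= tlen w.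
      rewrite leNgt; apply/negP => dw'.
      have := dc q (tlen w) qm; rewrite dw' ltW // => /(_ isT).
      by rewrite wq tfun_None // ltxx andbF.
    have lq' : tlen (ev (glist w d q)) = d q by rewrite lq; apply/min_idPr/ltW.
    rewrite (ent_Some wq) lq' /nrun_len ltn_ord; split=> [|x].
      have -> : Num.min (tlen w) (d q.+1) = d q.+1 by exact/min_idPr.
      have -> : Num.max 0 (d q.+1 - d q) = d q.+1 - d q.
        by apply/max_idPr; rewrite subr_ge0 ltW.
      by rewrite addrC subrK.
    rewrite /tcat_fun lq' fq; case: (ltP x (d q)) => xq.
      by rewrite (lt_trans xq dq).
    rewrite nrunE subr_ge0 xq /= ltrD2r; case: ltP => // xq'.
    by rewrite (dc q) ?xq // valK wq.
  have dw : tlen w <= d q.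
    rewrite leNgt; apply/negP => dw.
    by have := tfun_def w (d q); rewrite wq dq0 dw.
  have -> : ent w (d q) = n by rewrite /ent wq.
  have := @nrun_out n (d q.+1 - d q) (leqnn _) => nE.
  have -> : nrun_len n (d q.+1 - d q) = 0 by have := congr1 (@tlen R n) nE.
  have -> : tcat_fun (ev (glist w d q)) (nrun n (d q.+1 - d q))
     = ev (glist w d q) by rewrite nE; have := congr1 (@tfun R n) (tcatw0 (ev (glist w d q))).
  rewrite addr0 lq; split=> [|x].
    transitivity (tlen w); first exact/min_idPl.
    by apply/esym/min_idPl; rewrite (le_trans dw) // ltW.
  rewrite fq; case: ltP => xq; first by rewrite (lt_trans xq dq).
  by case: ltP => // xq'; rewrite (dc q) ?xq.
move/(_ m (leqnn m)) => [lm fm]; apply: timed_wordP => [|x].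
  by rewrite lm; apply/esym/min_idPl.
by rewrite fm; case: ltP => // mx; rewrite tfun_None // [x < _]ltNge (le_trans wm mx) andbF.
Qed.

(** The grid consists of [0] and all nonnegative lengths and breakpoints, sorted. Indices outside
    [ws] give [tempty], of length [0], so they need no separate treatment later. *)
Lemma common_grid (ws : seq (timed_word R n)) :
  exists d : nat -> R, exists m, [/\ d 0%N = 0,
    forall p, (p < m)%N -> d p < d p.+1 &
    forall i, nth tempty ws i = ev (glist (nth tempty ws i) d m)].
Proof.
have [D HD] : exists D : seq R, forall i, let w := nth tempty ws i in
    tlen w \in 0 :: D /\ forall x y, 0 <= x -> x <= y -> y < tlen w ->
    (forall z, z \in D -> ~~ (x <= z <= y)) -> w x = w y.
  elim: ws => [|w ws [D IH]].
    by exists [::] => i; rewrite nth_nil /= inE eqxx.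
  have [Dw Hw] := tfun_pc w; exists (tlen w :: Dw ++ D) => -[|i] /=.
    split=> [|x y x0 xy yw zD]; first by rewrite !inE eqxx orbT.
    by apply: Hw => // z zDw; apply: zD; rewrite inE mem_cat zDw orbT.
  have [lD H] := IH i; split=> [|x y x0 xy yw zD].
    by move: lD; rewrite !inE mem_cat => /orP[->//|->]; rewrite !orbT.
  by apply: H => // z zDw; apply: zD; rewrite inE mem_cat zDw !orbT.
pose D' := [seq x <- 0 :: D | 0 <= x].
pose e := sort <=%O (undup D').
have e_lt : sorted <%O e by rewrite sort_lt_sorted undup_uniq.
have e_mem x : (x \in e) = (0 <= x) && (x \in 0 :: D).
  by rewrite mem_sort mem_undup mem_filter.
have e0 : 0 \in e by rewrite e_mem lexx inE eqxx.
have e_gt0 : (0 < size e)%N by case: (e) e0.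
pose m := (size e).-1; pose d p := nth 0 e p.
have mE : size e = m.+1 by rewrite prednK.
have d_lt p q : (q <= m)%N -> (p < q)%N -> d p < d q.
  by move=> qm pq; apply: (sorted_ltn_nth lt_trans) => //;
     rewrite inE mE ltnS // (leq_trans (ltnW pq)).
have d_le p q : (q <= m)%N -> (p <= q)%N -> d p <= d q.
  by move=> qm; rewrite leq_eqVlt => /orP[/eqP-> //|/(d_lt _ _ qm)/ltW].
have d0 : d 0%N = 0.
  have : d 0%N \in e by apply: mem_nth.
  rewrite e_mem => /andP[d00 _]; apply/eqP; rewrite eq_le d00 andbT.
  have /(nthP 0) [q qs <-] := e0; apply: d_le => //.
  by rewrite -ltnS -mE.
exists d, m; split => // [p pm|i]; first exact: d_lt.
have [lD H] := HD i; set w := nth tempty ws i in lD H *.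
have lw : tlen w \in e by rewrite e_mem tlen_ge0.
have cell x p q : (p < m)%N -> d p < x < d p.+1 -> x = d q -> (q <= m)%N -> False.
  move=> pm /andP[px xp] xE qm; subst x; case: (leqP q p) => qp.
    by have := lt_le_trans px (d_le _ _ (ltnW pm) qp); rewrite ltxx.
  by have := lt_le_trans xp (d_le _ _ qm qp); rewrite ltxx.
apply: ev_glist => // [p pm|p x pm /andP[px xp]|]; first exact: d_lt.
- have dp0 : 0 <= d p by rewrite -d0; apply: d_le => //; exact: ltnW.
  have [xw|wx] := ltP x (tlen w); last first.
    rewrite tfun_None ?[x < _]ltNge ?wx ?andbF // tfun_None //.
    rewrite dp0 /=; apply/negbTE; rewrite -leNgt leNgt; apply/negP => dw.
    have /(nthP 0)[q qs qE] := lw.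
    apply: (cell (tlen w) p q pm) => //; last by rewrite -ltnS -mE.
    by rewrite dw (le_lt_trans wx).
  have [->//|xNp] := eqVneq x (d p).
  have px' : d p < x by rewrite lt_neqAle eq_sym xNp.
  have := @tfun_rc _ _ w (d p); rewrite dp0 (lt_trans px' xw) => /(_ isT) rc.
  (* The left end [d p] may itself be a breakpoint, so right continuity first moves to a point [y]
     inside the cell; no breakpoint lies in [[y, x]]. *)
  have [y [yx py yE]] : exists y, [/\ y < x, d p < y & w y = w (d p)].
    have N : \forall y \near (d p)^'+, [/\ y < x, d p < y & w y = w (d p)].
      near=> y; split; last by near: y.
        by near: y; exact: nbhs_right_lt.
      by near: y; exact: nbhs_right_gt.
    exact: filter_ex N.
  rewrite -yE; apply/esym/H => //; first by rewrite (le_trans dp0) // ltW.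
    exact: ltW.
  move=> z zD; apply/negP => /andP[yz zx].
  have z0 : 0 <= z by rewrite (le_trans dp0) // (le_trans (ltW py)).
  have /(nthP 0)[q qs qE] : z \in e by rewrite e_mem z0 inE zD orbT.
  apply: (cell z p q pm) => //; last by rewrite -ltnS -mE.
  by rewrite (lt_le_trans py yz) (le_lt_trans zx xp).
- have /(nthP 0)[q qs <-] := lw; apply: d_le => //.
  by rewrite -ltnS -mE.
Unshelve. all: by end_near. Qed.

End Words.

(** * Chains of strands *)

Section Strands.
Variables (R : realType) (n : nat).
Implicit Types (S P Q : nat -> nat) (s x z : seq (nat * R)) (g t : R).

Definition incr S := forall i, (S i < S i.+1)%N.
Definition sle S Q := forall i, (S i <= Q i)%N.
Definition hit S c := (c < n)%N /\ exists i, S i = c.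

(* Some chain over [s] from [P] to [Q] gains at least [g]. *)
Fixpoint ach s P Q g : Prop :=
  if s is (c, t) :: s' then
    exists S g', [/\ incr S, sle P S, ach s' S Q g' &
      g <= g' \/ hit S c /\ g <= g' + t]
  else sle P Q /\ g <= 0.

Lemma sle_refl S : sle S S. Proof. by move=> i. Qed.

Hint Resolve sle_refl : core.

Lemma sle_trans S2 S1 S3 : sle S1 S2 -> sle S2 S3 -> sle S1 S3.
Proof. by move=> H K i; apply: leq_trans (H i) (K i). Qed.

Lemma incr_lt S i j : incr S -> (i < j)%N -> (S i < S j)%N.
Proof.
move=> Si; elim: j => // j IH; rewrite ltnS leq_eqVlt => /orP[/eqP->|/IH ij].
  exact: Si.
exact: ltn_trans ij (Si j).
Qed.

Lemma incr_le S i j : incr S -> (i <= j)%N -> (S i <= S j)%N.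
Proof. by rewrite leq_eqVlt => Si /orP[/eqP->|/(incr_lt Si)/ltnW]. Qed.

Lemma incr_ge S i : incr S -> (i <= S i)%N.
Proof. by move=> Si; elim: i => // i IH; exact: leq_ltn_trans IH (Si i). Qed.

(** Because there are infinitely many strands, one at or above [b] always exists, so surgery never
    runs out of strands. *)
Lemma incr_first S b : incr S ->
  exists i, (b <= S i)%N /\ forall j, (j < i)%N -> (S j < b)%N.
Proof.
move=> Si; have ex : exists i, (b <= S i)%N by exists b; exact: incr_ge.
exists (ex_minn ex); case: ex_minnP => i bi min; split => // j ji.
by rewrite ltnNge; apply/negP => /min; rewrite leqNgt ji.
Qed.

Lemma ach_le s P P' Q Q' g g' :
  sle P' P -> sle Q Q' -> g' <= g -> ach s P Q g -> ach s P' Q' g'.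
Proof.
elim: s P P' g g' => [|[c t] s IH] P P' g g' PP QQ gg /=.
  by case=> PQ g0; split; [apply: sle_trans QQ; apply: sle_trans PQ | lra].
case=> S [h [iS PS hS gh]]; exists S, h; split => //.
- exact: sle_trans PS.
- exact: IH hS.
- by case: gh => [gh|[hc gh]]; [left; lra | right; split => //; lra].
Qed.

Lemma ach_sle s P Q g : ach s P Q g -> sle P Q.
Proof.
elim: s P g => [|[c t] s IH] P g /=; first by case.
by case=> S [h [_ PS /IH SQ _]]; apply: sle_trans SQ.
Qed.

Lemma ach_cat s s' P Q g : incr P -> ach (s ++ s') P Q g <->
  exists S g1 g2, [/\ incr S, ach s P S g1, ach s' S Q g2 & g <= g1 + g2].
Proof.
elim: s P g => [|[c t] s IH] P g iP /=.
  split=> [H|[S [g1 [g2 [iS [PS g1_0] H gg]]]]].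
    by exists P, 0, g; split => //; rewrite ?add0r.
  by apply: ach_le H => //; lra.
split=> [[S [h [iS PS /(IH _ _ iS)[T [g1 [g2 [iT H1 H2 hh]]]] gh]]]|].
  case: gh => [gh|[hc gh]].
    exists T, g1, g2; split => //; last by lra.
    by exists S, g1; split => //; left.
  exists T, (g1 + t), g2; split => //; last by lra.
  by exists S, g1; split => //; right.
move=> [T [g1 [g2 [iT [S [h [iS PS H1 gh]]] H2 gg]]]].
exists S, (h + g2); split => //.
  by apply/(IH _ _ iS); exists T, h, g2.
by case: gh => [gh|[hc gh]]; [left; lra | right; split => //; lra].
Qed.

Lemma ach1 c t P Q g : incr Q -> 0 <= t ->
  ach [:: (c, t)] P Q g <-> sle P Q /\
    (g <= 0 \/ g <= t /\ exists S, [/\ incr S, sle P S, sle S Q & hit S c]).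
Proof.
move=> iQ t0 /=; split.
  move=> [S [h [iS PS [SQ h0] gh]]]; split; first exact: sle_trans SQ.
  by case: gh => [gh|[hc gh]]; [left; lra | right; split; [lra|exists S]].
move=> [PQ [g0|[gt [S [iS PS SQ hc]]]]].
  by exists Q, 0; split => //; left; lra.
by exists S, 0; split => //; right; split => //; lra.
Qed.

(** The common tool of the surgeries: each position is deformed by [F], which may depend on the
    current letter and keeps every hit, so the gain survives. Monotonicity in the letter suffices
    because the letters of [x] weakly increase. *)
Lemma ach_map (F : (nat -> nat) -> nat -> nat -> nat) x P E P' E' g :
    sorted leq (map fst x) -> sle P' E' ->
    (forall S c, incr S -> sle P S -> sle S E -> c \in map fst x ->
       [/\ incr (F S c), sle P' (F S c), sle (F S c) E' &
          hit S c -> hit (F S c) c]) ->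
    (forall S S' c c', incr S -> incr S' -> sle P S -> sle S S' -> sle S' E ->
       c \in map fst x -> c' \in map fst x ->
       (c <= c')%N -> sle (F S c) (F S' c')) ->
  ach x P E g -> ach x P' E' g.
Proof.
elim: x P P' g => [|[c t] x IH] P P' g xs PE HF HM /=; first by case.
case=> S [h [iS PS hS gh]]; have SE := ach_sle hS.
have cx : c \in map fst ((c, t) :: x) by rewrite inE eqxx.
have [iF PF FE hF] := HF S c iS PS SE cx.
exists (F S c), h; split => //; last first.
  by case: gh => [gh|[/hF hc gh]]; [left | right].
move: xs; rewrite /= path_sortedE; last exact: leq_trans.
move=> /andP[/allP cs xs]; apply: (IH S (F S c)) => //.
- move=> S' c' iS' SS' S'E c'x.
  have c'x' : c' \in map fst ((c, t) :: x) by rewrite inE c'x orbT.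
  have [iF' PF' FE' hF'] := HF S' c' iS' (sle_trans PS SS') S'E c'x'.
  by split => //; apply: HM => //; exact: cs.
- move=> S1 S2 c1 c2 i1 i2 SS1 S12 S2E c1x c2x c12.
  apply: HM => //; first exact: sle_trans SS1.
    by rewrite inE c1x orbT.
  by rewrite inE c2x orbT.
Qed.

(** A position that hits [c] in one of the two parts can be held for the whole duration, which gains
    at least as much. *)
Lemma ach_merge c t t' s P Q g :
  0 <= t -> 0 <= t' ->
  ach ((c, t) :: (c, t') :: s) P Q g <-> ach ((c, t + t') :: s) P Q g.
Proof.
move=> t0 t'0; split=> /=.
  case=> S [h [iS PS [S' [h' [iS' SS' hS' hh']] gh]]].
  case: hh' => [hh'|[hc' hh']]; case: gh => [gh|[hc gh]].
  - exists S, h'; split => //; last by left; lra.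
    exact: ach_le hS'.
  - exists S, h'; split => //; last by right; split => //; lra.
    exact: ach_le hS'.
  - exists S', h'; split => //; last by right; split => //; lra.
    exact: sle_trans SS'.
  - exists S', h'; split => //; last by right; split => //; lra.
    exact: sle_trans SS'.
case=> S [h [iS PS hS gh]].
case: gh => [gh|[hc gh]].
  exists S, h; split => //; last by left.
  by exists S, h; split => //; left.
exists S, (h + t'); split => //; last by right; split => //; lra.
by exists S, h; split => //; right.
Qed.

Lemma ach_skip c t s P Q g : incr P -> (n <= c)%N ->
  ach ((c, t) :: s) P Q g <-> ach s P Q g.
Proof.
move=> iP nc; split=> /=.
  case=> S [h [iS PS hS [gh|[[cn _] _]]]]; first exact: ach_le hS.
  by move: cn; rewrite ltnNge nc.
by move=> H; exists P, g; split => //; left.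
Qed.

(** All increasing endpoints are allowed, not only those used for tableaux; this makes the relation
    a congruence for concatenation. *)
Definition aeq s s' :=
  forall P Q g, incr P -> incr Q -> ach s P Q g <-> ach s' P Q g.

Lemma aeq_refl s : aeq s s. Proof. by []. Qed.

Lemma aeq_sym s s' : aeq s s' -> aeq s' s.
Proof. by move=> H P Q g iP iQ; rewrite (H P Q g iP iQ). Qed.

Lemma aeq_trans s' s s'' : aeq s s' -> aeq s' s'' -> aeq s s''.
Proof. by move=> H K P Q g iP iQ; rewrite (H P Q g iP iQ); exact: K. Qed.

Lemma aeq_cat s1 s1' s2 s2' : aeq s1 s1' -> aeq s2 s2' ->
  aeq (s1 ++ s2) (s1' ++ s2').
Proof.
move=> H K P Q g iP iQ; rewrite !ach_cat //.
by split=> -[S [g1 [g2 [iS A1 A2 gg]]]]; exists S, g1, g2; split => //;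
   [exact/(H P S g1 iP iS) | exact/(K S Q g2 iS iQ)
   |exact/(H P S g1 iP iS) | exact/(K S Q g2 iS iQ)].
Qed.

End Strands.

#[local] Hint Resolve sle_refl : core.

(** * Surgery on chains for the Knuth relations between single letters and rows *)

Section ChainSurgery.
Variables (R : realType) (n : nat).
Implicit Types (S P Q : nat -> nat) (s x z : seq (nat * R)) (g t : R).
Local Notation ach := (ach n).
Local Notation hit := (hit n).

(* To hit [c] after [x], the first strand that ends up at or above [c] is capped
   at [c] throughout [x]. *)
Lemma knuth1_easy b c t x P Q g : 0 <= t ->
    sorted leq (map fst x) -> all (leq^~ b) (map fst x) -> (b < c)%N ->
    incr P -> incr Q ->
  ach ((c, t) :: x ++ [:: (b, t)]) P Q g -> ach (x ++ [:: (c, t); (b, t)]) P Q g.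
Proof.
move=> t0 xs /allP xb bc iP iQ /= [S [h [iS PS]]].
move=> /(ach_cat _ _ _ _ _ iS)[E [g1 [g2 [iE H1 H2 hh]]] gh].
have SE := ach_sle H1; have EQ := ach_sle H2.
apply/(ach_cat _ _ _ _ _ iP).
case: gh => [gh|[[cn [j Sj]] gh]].
  exists E, g1, g2; split => //; last by lra.
    exact: ach_le H1.
  by exists E, g2; split => //; left.
have [i [ci iE']] := incr_first c iE.
have ij : (i <= j)%N.
  by rewrite leqNgt; apply/negP => /iE'; rewrite ltnNge -Sj SE.
pose F S' l := if l == i then minn (S' i) c else S' l : nat.
have iF S' : incr S' -> sle S' E -> incr (F S').
  move=> iS' S'E l; have A1 := iS' l; have A2 := S'E l; have A3 := iE' l.
  by rewrite /F; have [li|li] := eqVneq l i; have [li'|li'] := eqVneq l.+1 i;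
    subst => //; lia.
have FE S' : sle S' E -> sle (F S') E.
  move=> S'E l; rewrite /F; have := S'E l; case: eqP => [->|]; lia.
exists (F E), g1, (g2 + t); split; last by lra.
- exact: iF.
- apply: (@ach_map _ _ (fun S _ => F S) x S E) => //.
  + move=> l; have A1 := PS l; have A2 := SE l; rewrite /F; case: eqP => [li|_].
      by subst l; have := incr_le iS ij; lia.
    by lia.
  + move=> S' a iS' SS' S'E ax; split => //; first exact: iF.
      move=> l; have A1 := PS l; have A2 := SS' l; rewrite /F.
      by case: eqP => [li|_]; [subst l; have := incr_le iS ij; lia | lia].
      by move=> l; rewrite /F; have := S'E l; case: eqP => [->|]; lia.
    case=> an [l El]; split => //; exists l; rewrite /F; case: eqP => // li.
    by subst l; have := xb _ ax; lia.
  + move=> S1 S2 a a' i1 i2 _ S12 S2E _ _ _ l; rewrite /F.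
    by have := S12 l; case: eqP => [->|]; lia.
- exists (F E), g2; split => //; first exact: iF.
    by apply: ach_le H2 => //; exact: FE.
  right; split; last by [].
  by split => //; exists i; rewrite /F eqxx; lia.
Qed.

(** Mirror image of [knuth1_easy]: to hit [b] before [z], the last strand at or below [b] is kept at
    or above [b] throughout [z]. Letters of [z] exceed [b], so no hit is lost. *)
Lemma knuth2_easy b c t z P Q g : 0 <= t ->
    sorted leq (map fst z) -> all (leq c) (map fst z) -> (b < c)%N ->
    incr P -> incr Q ->
  ach ((c, t) :: z ++ [:: (b, t)]) P Q g -> ach ((c, t) :: (b, t) :: z) P Q g.
Proof.
move=> t0 zs /allP zc bc iP iQ /= [S [h [iS PS]]].
move=> /(ach_cat _ _ _ _ _ iS)[E [g1 [g2 [iE H1]]]].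
move/(ach1 _ _ _ _ iQ t0) => [EQ H2] hh gh.
have SE := ach_sle H1.
exists S, h; split => //.
case: H2 => [g20|[g2t [T [iT ET TQ [bn [j Tj]]]]]].
  exists S, h; split => //; last by left.
  by apply: ach_le H1 => //; lra.
have [i' [ci Hi]] := incr_first b.+1 iS.
have Sj : (S j <= b)%N by have := SE j; have := ET j; lia.
have ji : (j < i')%N by rewrite ltnNge; apply/negP => /(incr_le iS); lia.
case: i' ci Hi ji => // i ci Hi ji.
pose F S' l := if l == i then maxn (S' i) b else S' l : nat.
(* Strand [j <= i] hits [b] after [z], so strand [i] can afford to be raised to [b]. *)
have bQ : (b <= Q i)%N.
  have := incr_le iT (ji : j <= i)%N; have := TQ i; lia.
have iF S' : incr S' -> sle S S' -> incr (F S').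
  move=> iS' SS' l; have A1 := iS' l; have A2 := SS' l.+1.
  by rewrite /F; have [li|li] := eqVneq l i; have [li'|li'] := eqVneq l.+1 i;
    subst => //; lia.
have SF S' : sle S S' -> sle S (F S').
  by move=> SS' l; rewrite /F; have := SS' l; case: eqP => [->|]; lia.
have FQ S' : sle S' E -> sle (F S') Q.
  move=> S'E l; rewrite /F; have A1 := S'E l; have A2 := EQ l.
  by case: eqP => [li|]; [subst l|]; lia.
exists (F S), g1; split => //.
- exact: iF.
- exact: SF.
- apply: (@ach_map _ _ (fun S _ => F S) z S E) => //.
  + exact: FQ.
  + move=> S' a iS' SS' S'E az; split; [exact: iF| |exact: FQ|].
      by move=> l; rewrite /F; have := SS' l; case: eqP => [->|]; lia.
    case=> an [l El]; split => //; exists l; rewrite /F; case: eqP => // li.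
    by subst l; have := zc _ az; lia.
  + move=> S1 S2 a a' i1 i2 _ S12 S2E _ _ _ l; rewrite /F.
    by have := S12 l; case: eqP => [->|]; lia.
- right; split; last by lra.
  split => //; exists i; rewrite /F eqxx.
  by have := Hi i (ltnSn i); lia.
Qed.


(* If both [c] and [b] are hit, by the strands [j] and [k] with [k < j], then
   strand [k] alone can collect every letter of [x] hit by a strand [>= k]; the
   strands above [k] may thus jump to their final position before [x]. *)
Lemma knuth1_hard b c t x P Q g : 0 <= t ->
    sorted leq (map fst x) -> all (leq^~ b) (map fst x) -> (b < c)%N ->
    incr P -> incr Q ->
  ach (x ++ [:: (c, t); (b, t)]) P Q g -> ach ((c, t) :: x ++ [:: (b, t)]) P Q g.
Proof.
move=> t0 xs /allP xb bc iP iQ /(ach_cat _ _ _ _ _ iP).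
move=> [E [g1 [g2 [iE H1 [S [g3 [iS ES]]]]]]].
move=> /(ach1 _ _ _ _ iQ t0) [SQ H3] gh gg.
have {}H1 : ach x P S g1 by apply: ach_le H1.
have PS := ach_sle H1.
have last_b T T' g' : incr T -> ach x T T' g' -> incr T' -> sle T' Q ->
    (exists k, T' k = b) -> (b < n)%N -> ach (x ++ [:: (b, t)]) T Q (g' + t).
  move=> iT A iT' T'Q Tb bn; apply/(ach_cat _ _ _ _ _ iT).
  exists T', g', t; split => //; apply/ach1 => //; split => //.
  by right; split => //; exists T'.
have no_b T T' g' : incr T -> ach x T T' g' -> incr T' -> sle T' Q ->
    ach (x ++ [:: (b, t)]) T Q g'.
  move=> iT A iT' T'Q; apply/(ach_cat _ _ _ _ _ iT).
  exists T', g', 0; split => //; last by lra.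
  by apply/ach1 => //; split => //; left.
have first_c W g' : incr W -> sle P W -> (exists j, W j = c) -> (c < n)%N ->
    ach (x ++ [:: (b, t)]) W Q g' -> g <= g' + t ->
    ach ((c, t) :: x ++ [:: (b, t)]) P Q g.
  by move=> iW PW Wc cn A le_g; exists W, g'; split => //; right.
have skip_c g' : ach (x ++ [:: (b, t)]) P Q g' -> g <= g' ->
    ach ((c, t) :: x ++ [:: (b, t)]) P Q g.
  by move=> A le_g; exists P, g'; split => //; left.
case: gh => [gh|[[cn [j Sj]] gh]].
  case: H3 => [g30|[g3t [T [iT ST TQ [bn [k Tk]]]]]].
    apply: (skip_c g1); last by lra.
    exact: (no_b P S).
  apply: (skip_c (g1 + t)); last by lra.
  apply: (last_b P T) => //; last by exists k.
  exact: ach_le H1.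
case: H3 => [g30|[g3t [T [iT ST TQ [bn [k Tk]]]]]].
  (* Only [c] is hit: either [b] can be hit at the end instead, or the strands
     up to [c] can jump before [x] without losing any letter of [x]. *)
  have [i [bi Hi]] := incr_first b.+1 iS.
  have ij : (i <= j)%N by rewrite leqNgt; apply/negP => /Hi; lia.
  have [/andP[i0 Qb]|Qb] := boolP ((0 < i)%N && (b <= Q i.-1)%N).
    case: i i0 Qb bi Hi ij => // i _ /= Qb bi Hi ij.
    pose V l := if l == i then b else S l.
    have bn : (b < n)%N by lia.
    apply: (skip_c (g1 + t)); last by lra.
    apply: (last_b P V) => //; last by exists i; rewrite /V eqxx.
    - apply: ach_le H1 => // l; rewrite /V; case: eqP => [li|//].
      by subst l; have := Hi i (ltnSn i); lia.
    - move=> l; have A1 := iS l; have A2 := Hi l; have A3 := Hi l.+1.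
      by rewrite /V; have [li|li] := eqVneq l i; have [li'|li'] := eqVneq l.+1 i;
        subst => //; lia.
    - by move=> l; rewrite /V; have := SQ l; case: eqP => [->|]; lia.
  (* If strand [i] starts at or below [b], it is capped at [b] throughout [x]; strand [i.-1], if
     any, ends below [b] and leaves room. *)
  have [Pb|Pb] := leqP (P i) b.
    have bn : (b < n)%N by lia.
    pose F S' l := if l == i then minn (S' i) b else S' l : nat.
    have iF S' : incr S' -> sle S' S -> incr (F S').
      move=> iS' S'S l; have A1 := iS' l; have A2 := S'S l; have A3 := SQ l.
      by rewrite /F; have [li|li] := eqVneq l i; have [li'|li'] := eqVneq l.+1 i;
        subst => //; move: Qb; rewrite ?ltn0Sn /=; lia.
    have FS S' : sle S' S -> sle (F S') S.
      by move=> S'S l; rewrite /F; have := S'S l; case: eqP => [->|]; lia.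
    have PF S' : sle P S' -> sle P (F S').
      by move=> PS' l; rewrite /F; have := PS' l; case: eqP => [->|]; lia.
    apply: (skip_c (g1 + t)); last by lra.
    apply: (last_b P (F S)) => //.
    + apply: (@ach_map _ _ (fun S _ => F S) x P S) => //; first exact: PF.
        move=> S' a iS' PS' S'S ax; split; [exact: iF|exact: PF| |].
          move=> l; rewrite /F; have := S'S l; case: eqP => [->|]; lia.
        case=> an [l El]; split => //; exists l; rewrite /F; case: eqP => // li.
        by subst l; have := xb _ ax; lia.
      move=> S1 S2 a a' i1 i2 _ S12 S2E _ _ _ l; rewrite /F.
      by have := S12 l; case: eqP => [->|]; lia.
    + exact: iF.
    + by apply: sle_trans SQ; exact: FS.
    + by exists i; rewrite /F eqxx; lia.
  (* Strands from [i] on start above [b], hence above all of [x]; sending them to [S] before [x]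
     costs no hit. *)
  pose F S' l := if (l < i)%N then S' l else S l : nat.
  have iF S' : incr S' -> sle S' S -> incr (F S').
    move=> iS' S'S l; have A1 := iS' l; have A2 := S'S l; have A3 := iS l.
    by rewrite /F; case: (ltnP l i); case: (ltnP l.+1 i) => //; lia.
  have FS S' : sle S' S -> sle (F S') S.
    by move=> S'S l; rewrite /F; have := S'S l; case: ifP; lia.
  have PF S' : sle P S' -> sle P (F S').
    by move=> PS' l; rewrite /F; have := PS' l; have := PS l; case: ifP; lia.
  apply: (first_c (F P) g1) => //; [exact: iF|exact: PF| | |lra].
    by exists j; rewrite /F ltnNge ij.
  apply: (no_b (F P) S) => //; first exact: iF.
  apply: (@ach_map _ _ (fun S _ => F S) x P S) => //; first exact: FS.
    move=> S' a iS' PS' S'S ax; split; [exact: iF| |exact: FS|].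
      by move=> l; rewrite /F; have := PS' l; case: ifP; lia.
    case=> an [l El]; split => //; exists l; rewrite /F; case: ifPn => //.
    rewrite -leqNgt => /(incr_le iP).
    by have := xb _ ax; have := PS' l; lia.
  move=> S1 S2 a a' i1 i2 _ S12 S2E _ _ _ l; rewrite /F.
  by have := S12 l; case: ifP; lia.
have kj : (k < j)%N.
  by rewrite ltnNge; apply/negP => /(incr_le iT); have := ST j; lia.
have [i [ci Hi]] := incr_first c iT.
have ij : (i <= j)%N by rewrite leqNgt; apply/negP => /Hi; have := ST j; lia.
have ki : (k < i)%N by rewrite ltnNge; apply/negP => /(incr_le iT); lia.
have Pi : (P i <= c)%N by have := PS j; have := incr_le iP ij; lia.
(* [V] is [T] with its first strand at or above [c] lowered to [c]: it hits [c] before [x], and [T]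
   is still reachable afterwards. *)
pose V l := if l == i then c else T l.
have iV : incr V.
  move=> l; have A1 := iT l; have A2 := Hi l.
  by rewrite /V; have [li|li] := eqVneq l i; have [li'|li'] := eqVneq l.+1 i;
    subst => //; lia.
have PV : sle P V.
  move=> l; have := PS l; have := ST l; rewrite /V.
  by case: eqP => [li|_]; [subst l|]; lia.
have VT : sle V T by move=> l; rewrite /V; case: eqP => // ->.
pose F S' a l := if (l < k)%N then S' l else
  if l == k then maxn (S' k) a else V l : nat.
have Vk : (b < V k.+1)%N.
  by have := iT k; rewrite /V; case: eqP => _; lia.
pose W l := if (l <= k)%N then P l else V l.
have iW : incr W.
  move=> l; have A1 := iP l; have A2 := iV l; have A3 := PV l.+1; rewrite /W.
  by case: (ltnP l k); case: (leqP l k); lia.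
have iF S' a : incr S' -> sle S' S -> (a <= b)%N -> incr (F S' a).
  move=> iS' S'S ab l; have A1 := iS' l; have A2 := iV l.
  have A3 := S'S l; have A4 := ST l.
  rewrite /F; case: (ltngtP l k) => lk; case: (ltngtP l.+1 k) => lk';
    subst => //; lia.
have FT S' a : sle S' S -> (a <= b)%N -> sle (F S' a) T.
  move=> S'S ab l; have A1 := S'S l; have A2 := ST l; have A3 := VT l.
  rewrite /F; case: (ltngtP l k) => lk; subst => //; lia.
have WF S' a : sle P S' -> sle W (F S' a).
  move=> PS' l; have A1 := PS' l; rewrite /W /F.
  by case: (ltngtP l k) => lk; subst => //; lia.
apply: (first_c W (g1 + t)) => //; [| | |lra].
- by move=> l; rewrite /W; case: ifP.
- by exists i; rewrite /W /V leqNgt ki eqxx.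
apply: (last_b W T) => //; last by exists k.
apply: (@ach_map _ _ F x P S) => //.
- move=> l; rewrite /W; case: ifP => // _.
  exact: leq_trans (PS l) (ST l).
- move=> S' a iS' PS' S'S /xb ab; split; [exact: iF|exact: WF|exact: FT|].
  case=> an [l El]; split => //.
  have [lk|kl] := ltnP l k; first by exists l; rewrite /F lk.
  exists k; rewrite /F ltnn eqxx; apply/maxn_idPr.
  by rewrite -El; apply: incr_le.
- move=> S1 S2 a a' i1 i2 _ S12 S2E _ _ aa l; rewrite /F.
  by have := S12 l; case: (ltngtP l k) => lk; subst => //; lia.
Qed.

(** If [c] and [b] are hit by strands [j] and [k], then [k < j], and strand [j] alone can collect
    every letter of [z] hit by a strand [<= j]; the strands below [j] wait until after [z]. If only
    [b] is hit, [c < n] allows the exchange for a hit of [c]. *)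
Lemma knuth2_hard b c t z P Q g : 0 <= t ->
    sorted leq (map fst z) -> all (leq c) (map fst z) -> (b < c < n)%N ->
    incr P -> incr Q ->
  ach ((c, t) :: (b, t) :: z) P Q g -> ach ((c, t) :: z ++ [:: (b, t)]) P Q g.
Proof.
move=> t0 zs /allP zc /andP[bc cn] iP iQ [T [h0 [iT PT [S [h [iS TS H1]]] hh gh]]].
have SQ := ach_sle H1; have PS := sle_trans PT TS.
have no_b W g' : incr W -> ach z W Q g' -> ach (z ++ [:: (b, t)]) W Q g'.
  move=> iW A; apply/(ach_cat _ _ _ _ _ iW).
  exists Q, g', 0; split => //; last by lra.
  by apply/ach1 => //; split => //; left.
have hit_c W g' : incr W -> sle P W -> (exists j, W j = c) -> (c < n)%N ->
    ach (z ++ [:: (b, t)]) W Q g' -> g <= g' + t ->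
    ach ((c, t) :: z ++ [:: (b, t)]) P Q g.
  by move=> iW PW Wc _ A le_g; exists W, g'; split => //; right.
have skip_c g' : ach (z ++ [:: (b, t)]) P Q g' -> g <= g' ->
    ach ((c, t) :: z ++ [:: (b, t)]) P Q g.
  by move=> A le_g; exists P, g'; split => //; left.
have last_b W W' g' : incr W -> ach z W W' g' -> incr W' -> sle W' Q ->
    (exists k, W' k = b) -> (b < n)%N -> ach (z ++ [:: (b, t)]) W Q (g' + t).
  move=> iW A iW' W'Q Wb bn; apply/(ach_cat _ _ _ _ _ iW).
  exists W', g', t; split => //; apply/ach1 => //; split => //.
  by right; split => //; exists W'.
case: hh => [hh|[[bn [k Sk]] hh]].
  case: gh => [gh|[[_ [j Tj]] gh]].
    apply: (skip_c h); last by lra.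
    by apply: no_b => //; exact: ach_le H1.
  apply: (hit_c T h) => //; [by exists j| |lra].
  by apply: no_b => //; exact: ach_le H1.
case: gh => [gh|[[_ [j Tj]] gh]].
  (* Only [b] is hit: either [c] can be hit at the start instead, or the
     strands up to [b] can wait until after [z]. *)
  have [i [ci Hi]] := incr_first c iS.
  have ki : (k < i)%N by rewrite ltnNge; apply/negP => /(incr_le iS); lia.
  case: i ki ci Hi => // i ki ci Hi.
  have [Pc|Pc] := leqP (P i.+1) c.
    pose V l := if l == i.+1 then c else S l.
    have iV : incr V.
      move=> l; have A1 := iS l; have A2 := Hi l; rewrite /V.
      by have [li|li] := eqVneq l i.+1; have [li'|li'] := eqVneq l.+1 i.+1;
        subst => //; lia.
    apply: (hit_c V h) => //; [| | |lra].
    - by move=> l; have := PS l; rewrite /V; case: eqP => [li|//]; subst l; lia.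
    - by exists i.+1; rewrite /V eqxx.
    - apply: no_b => //; apply: ach_le H1 => // l.
      by rewrite /V; case: eqP => [->|]; lia.
  (* Strand [i], the last one below [c] in [S], can be kept at or above [c] throughout [z] if it
     ends there: strand [i.+1] is always above [c]. *)
  have [cQ|Qc] := leqP c (Q i).
    pose F S' l := if l == i then maxn (S' i) c else S' l : nat.
    have iF S' : incr S' -> sle S S' -> incr (F S').
      move=> iS' SS' l; have A1 := iS' l; have A2 := SS' l.+1; have A3 := PS l.+1.
      by rewrite /F; have [li|li] := eqVneq l i; have [li'|li'] := eqVneq l.+1 i;
        subst => //; lia.
    have SF S' : sle S S' -> sle S (F S').
      by move=> SS' l; rewrite /F; have := SS' l; case: eqP => [->|]; lia.
    have FQ S' : sle S' Q -> sle (F S') Q.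
      move=> S'Q l; rewrite /F; have A1 := S'Q l.
      by case: eqP => [li|]; [subst l|]; lia.
    apply: (hit_c (F S) h); [exact: iF| | |by []| |lra].
    - by apply: sle_trans PS _; exact: SF.
    - by exists i; rewrite /F eqxx; have := Hi i (ltnSn i); lia.
    apply: no_b; first exact: iF.
    apply: (@ach_map _ _ (fun S _ => F S) z S Q) => //; first exact: FQ.
      move=> S' a iS' SS' S'Q /zc ca; split; [exact: iF| |exact: FQ|].
        by move=> l; rewrite /F; have := SS' l; case: eqP => [->|]; lia.
      case=> an [l El]; split => //; exists l; rewrite /F; case: eqP => // li.
      by subst l; lia.
    move=> S1 S2 a a' i1 i2 _ S12 S2E _ _ _ l; rewrite /F.
    by have := S12 l; case: eqP => [->|]; lia.
  (* Strands up to [i] end below [c] and hit nothing in [z]; they stay at [S], where strand [k] hits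
     [b] after [z]. *)
  pose F S' l := if (l <= i)%N then S l else S' l : nat.
  have iF S' : incr S' -> sle S S' -> incr (F S').
    move=> iS' SS' l; have A1 := iS' l; have A2 := SS' l.+1; have A3 := iS l.
    by rewrite /F; case: (leqP l i); case: (leqP l.+1 i) => //; lia.
  have FQ S' : sle S' Q -> sle (F S') Q.
    by move=> S'Q l; rewrite /F; have := S'Q l; have := SQ l; case: ifP; lia.
  have PF S' : sle S S' -> sle P (F S').
    move=> SS' l; rewrite /F; have := SS' l; have := PS l; case: ifP; lia.
  apply: (skip_c (h + t)); last by lra.
  apply: (last_b P (F Q)) => //.
  - apply: (@ach_map _ _ (fun S _ => F S) z S Q) => //; first exact: PF.
      move=> S' a iS' SS' S'Q /zc ca; split; [exact: iF|exact: PF| |].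
        by move=> l; rewrite /F; have := S'Q l; case: ifP; lia.
      case=> an [l El]; split => //; exists l; rewrite /F; case: ifPn => // li.
      by have := incr_le iQ li; have := S'Q l; lia.
    move=> S1 S2 a a' i1 i2 _ S12 S2E _ _ _ l; rewrite /F.
    by have := S12 l; case: ifP; lia.
  - by apply: iF.
  - exact: FQ.
  - by exists k; rewrite /F -ltnS ki.
have kj : (k < j)%N.
  by rewrite ltnNge; apply/negP => /(incr_le iS); have := TS j; lia.
have [i' [ci Hi]] := incr_first b.+1 iT.
have ki' : (k < i')%N.
  by rewrite ltnNge; apply/negP => /(incr_le iT); have := TS k; lia.
have ij' : (i' <= j)%N.
  by rewrite leqNgt; apply/negP => /Hi; lia.
case: i' ci Hi ki' ij' => // i ci Hi ki ij.
have bQ : (b <= Q i)%N by have := incr_le iS (ki : k <= i)%N; have := SQ i; lia.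
(* [V] is [T] with its last strand at or below [b] raised to [b], where it waits to be hit after
   [z]. *)
pose V l := if l == i then b else T l.
have iV : incr V.
  move=> l; have A1 := iT l; have A2 := Hi l.+1; rewrite /V.
  by have [li|li] := eqVneq l i; have [li'|li'] := eqVneq l.+1 i;
    subst => //; lia.
have TQ := sle_trans TS SQ.
have VQ : sle V Q.
  by move=> l; rewrite /V; have := TQ l; case: eqP => [li|_]; [subst l|]; lia.
have TV : sle T V.
  move=> l; rewrite /V; case: eqP => // ->; have := Hi i (ltnSn i); lia.
have Vj : (V j.-1 < c)%N.
  by case: (j) ij Tj => //= j' _ Tj; have := iT j'; rewrite /V; case: eqP; lia.
pose F S' a l := if (l < j)%N then V l else
  if l == j then minn (S' j) a else S' l : nat.
pose W l := if (l < j)%N then V l else Q l.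
have iW : incr W.
  move=> l; have A1 := iV l; have A2 := iQ l; have A3 := VQ l.+1; rewrite /W.
  by case: (ltnP l j); case: (ltnP l.+1 j); lia.
have WQ : sle W Q by move=> l; rewrite /W; case: ifP.
have iF S' a : incr S' -> sle S S' -> (c <= a)%N -> incr (F S' a).
  move=> iS' SS' ca l; have A1 := iS' l; have A2 := iV l; have A3 := SS' l.+1.
  have A4 := TS l.+1; rewrite /F.
  case: (ltngtP l j) => lj; case: (ltngtP l.+1 j) => lj'; try lia.
    by move: Vj; rewrite -lj' /=; rewrite -lj' in Tj; lia.
  by subst l; lia.
have TF S' a : sle S S' -> (c <= a)%N -> sle T (F S' a).
  move=> SS' ca l; have A1 := SS' l; have A2 := TS l; have A3 := TV l.
  by rewrite /F; case: (ltngtP l j) => lj; subst => //; lia.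
have FW S' a : sle S' Q -> sle (F S' a) W.
  move=> S'Q l; have A1 := S'Q l; rewrite /W /F.
  by case: (ltngtP l j) => lj; subst => //; lia.
apply: (hit_c T (h + t)) => //; [by exists j| |lra].
apply: (last_b T W) => //; last first.
  by exists i; rewrite /W /V ij eqxx.
apply: (@ach_map _ _ F z S Q) => //.
- move=> l; rewrite /W; case: ifP => // _; exact: TQ.
- move=> S' a iS' SS' S'Q /zc ca; split; [exact: iF|exact: TF|exact: FW|].
  case=> an [l El]; split => //.
  have [lj|jl] := leqP l j; last first.
    by exists l; rewrite /F ltnNge (ltnW jl) gtn_eqF.
  exists j; rewrite /F ltnn eqxx; apply/minn_idPr.
  by rewrite -El; apply: incr_le.
- move=> S1 S2 a a' i1 i2 _ S12 S2E _ _ aa l; rewrite /F.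
  by have := S12 l; case: (ltngtP l j) => lj; subst => //; lia.
Qed.

End ChainSurgery.

(** * Invariance under Knuth equivalence *)

Section Invariance.
Variables (R : realType) (n : nat).
Implicit Types (P Q : nat -> nat) (s : seq (nat * R)) (g t : R).
Implicit Types (u v w : timed_word R n).
Local Notation ach := (ach n).
Local Notation aeq := (aeq n).

Lemma aeq_knuth1 b c t x : 0 <= t ->
    sorted leq (map fst x) -> all (leq^~ b) (map fst x) -> (b < c)%N ->
  aeq (x ++ [:: (c, t); (b, t)]) ((c, t) :: x ++ [:: (b, t)]).
Proof.
by move=> t0 xs xb bc P Q g iP iQ; split; [exact: knuth1_hard | exact: knuth1_easy].
Qed.

Lemma aeq_knuth2 b c t z : 0 <= t ->
    sorted leq (map fst z) -> all (leq c) (map fst z) -> (b < c < n)%N ->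
  aeq ((c, t) :: (b, t) :: z) ((c, t) :: z ++ [:: (b, t)]).
Proof.
move=> t0 zs zc bcn P Q g iP iQ; split; first exact: knuth2_hard.
by apply: knuth2_easy => //; case/andP: bcn.
Qed.

(** * From single letters to the timed Knuth relations *)

Section Triples.
Implicit Types tr : seq (nat * nat * R).

(** A triple [(b, c, t)] is a cell of duration [t] on which one row has the letter [b] and the other
    the larger letter [c]; this encodes two rows of equal length cut alike. *)
Definition low tr : seq (nat * R) := [seq (q.1.1, q.2) | q <- tr].
Definition high tr : seq (nat * R) := [seq (q.1.2, q.2) | q <- tr].

Definition separated tr :=
  [/\ all (fun q => 0 <= q.2) tr, all (fun q => (q.1.2 < n)%N) tr &
      forall p q, p \in tr -> q \in tr -> (p.1.1 < q.1.2)%N].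

Lemma separated_cat tr tr' : separated (tr ++ tr') -> separated tr /\ separated tr'.
Proof.
case; rewrite !all_cat => /andP[a1 a2] /andP[b1 b2] H.
by split; split => // x y xt yt; apply: H; rewrite mem_cat ?xt ?yt ?orbT.
Qed.

Lemma sorted_cat_leq (s s' : seq nat) : sorted leq (s ++ s') =
  [&& sorted leq s, sorted leq s' & allrel leq s s'].
Proof.
by rewrite !(sorted_pairwise leq_trans) pairwise_cat andbC -andbA.
Qed.

(** Induction peeling the first cell [(b, c, t)]: [b] moves left across the remaining high letters
    ([aeq_knuth2]), [c] moves left across [x] ([aeq_knuth1]), and [x] followed by [b] is the new
    [x]. *)
Lemma aeq_kappa1 tr x : separated tr ->
    sorted leq (map fst (x ++ low tr)) -> sorted leq (map fst (high tr)) ->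
  aeq (x ++ high tr ++ low tr) (high tr ++ x ++ low tr).
Proof.
elim: tr x => [|[[b c] t] tr IH] x; first by move=> *; exact: aeq_refl.
move=> sep xs cs; have /(@separated_cat [:: _])[_ sep'] := sep.
have [/andP[/= t0 _] /andP[/= cn _] H] := sep.
have bc : (b < c)%N by have := H _ _ (mem_head _ _) (mem_head _ _).
move: (xs) (cs); rewrite /= map_cat sorted_cat_leq /= => /and3P[xs1 _].
rewrite allrel_consr => /andP[xb _].
rewrite path_sortedE; last exact: leq_trans.
move=> /andP[cC Cs].
set L := low tr in xs *; set C := high tr in cC Cs *.
apply: (@aeq_trans _ _ (x ++ ((c, t) :: (b, t) :: C) ++ L)).
  have -> : x ++ (c, t) :: C ++ (b, t) :: L =
    x ++ ((c, t) :: C ++ [:: (b, t)]) ++ L by rewrite /= -catA.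
  apply/aeq_cat/aeq_cat; try exact: aeq_refl.
  by apply/aeq_sym/aeq_knuth2; rewrite ?bc.
apply: (@aeq_trans _ _ (((c, t) :: x ++ [:: (b, t)]) ++ C ++ L)).
  have -> : x ++ ((c, t) :: (b, t) :: C) ++ L =
    (x ++ [:: (c, t); (b, t)]) ++ C ++ L by rewrite /= -catA.
  by apply: aeq_cat; [apply: aeq_knuth1 | exact: aeq_refl].
have -> : (c, t) :: C ++ x ++ (b, t) :: L =
  [:: (c, t)] ++ C ++ (x ++ [:: (b, t)]) ++ L by rewrite /= -catA.
have -> : ((c, t) :: x ++ [:: (b, t)]) ++ C ++ L =
  [:: (c, t)] ++ (x ++ [:: (b, t)]) ++ C ++ L by rewrite /= -catA.
apply: aeq_cat; first exact: aeq_refl.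
by apply: IH => //; rewrite -catA.
Qed.

(** Mirror image, peeling the last cell [(b, c, t)]: the induction is applied with [c] prepended to
    [z], after which [b] crosses [z] and [c] crosses the remaining low letters. *)
Lemma aeq_kappa2 tr z : separated tr ->
    sorted leq (map fst (low tr)) -> sorted leq (map fst (high tr ++ z)) ->
  aeq (high tr ++ low tr ++ z) (high tr ++ z ++ low tr).
Proof.
elim/last_ind: tr z => [|tr [[b c] t] IH] z.
  by move=> *; rewrite /= cats0; exact: aeq_refl.
rewrite -cats1 => sep bs zs; have [sep' [/andP[/= t0 _] /andP[/= cn _] H]] := separated_cat sep.
have bc : (b < c)%N by have := H _ _ (mem_head _ _) (mem_head _ _).
move: bs zs; rewrite /low /high !map_cat /= -/(low _) -/(high _).
set L := low tr; set C := high tr.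
rewrite sorted_cat_leq => /and3P[Ls _]; rewrite allrel1r => Lb.
rewrite -catA => zs; have := zs; rewrite sorted_cat_leq => /and3P[_ cz _].
have [zs' zc] : sorted leq (map fst z) /\ all (leq c) (map fst z).
  by move: cz; rewrite /= path_sortedE; [case/andP|exact: leq_trans].
apply/aeq_sym/(@aeq_trans _ _ ((C ++ L ++ (c, t) :: z) ++ [:: (b, t)])).
  have -> : (C ++ [:: (c, t)]) ++ z ++ L ++ [:: (b, t)] =
    (C ++ ((c, t) :: z) ++ L) ++ [:: (b, t)] by rewrite -!catA.
  apply: aeq_cat; last exact: aeq_refl.
  apply/aeq_sym/IH => //.
  by rewrite map_cat.
apply: (@aeq_trans _ _ (C ++ L ++ (c, t) :: (b, t) :: z)).
  have -> : (C ++ L ++ (c, t) :: z) ++ [:: (b, t)] =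
    C ++ L ++ ((c, t) :: z ++ [:: (b, t)]) by rewrite -!catA.
  apply/aeq_cat/aeq_cat; try exact: aeq_refl.
  by apply/aeq_sym/aeq_knuth2; rewrite ?bc.
have -> : C ++ L ++ (c, t) :: (b, t) :: z =
  C ++ (L ++ [:: (c, t); (b, t)]) ++ z by rewrite -!catA.
have -> : (C ++ [:: (c, t)]) ++ (L ++ [:: (b, t)]) ++ z =
  C ++ ((c, t) :: L ++ [:: (b, t)]) ++ z by rewrite -!catA /= -catA.
apply/aeq_cat/aeq_cat; try exact: aeq_refl.
exact: aeq_knuth1.
Qed.

End Triples.

(** * Independence of the chosen runs, and invariance on words *)

Definition pos s := all (fun q => 0 < q.2) s.

Lemma pos_cat s s' : pos (s ++ s') = pos s && pos s'.
Proof. exact: all_cat. Qed.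

Lemma ev_pos_len a t s : (a < n)%N -> 0 < t -> 0 < tlen (ev n ((a, t) :: s)).
Proof.
move=> an t0; rewrite ev_cons.
change (0 < tlen (nrun n a t) + tlen (ev n s)).
by rewrite ltr_wpDr ?tlen_ge0 // tlen_nrun // ltW.
Qed.

Lemma ev_at0 a t s : (a < n)%N -> 0 < t -> ev n ((a, t) :: s) 0 = insub a.
Proof.
move=> an t0; rewrite ev_cons [LHS]/= /tcat_fun tlen_nrun ?ltW // t0.
by rewrite nrunE lexx t0.
Qed.

Lemma insub_inj a b : (a < n)%N -> (b < n)%N ->
  insub a = insub b :> option 'I_n -> a = b.
Proof. by move=> an bn; rewrite !insubT => -[]. Qed.

(** Induction on the total number of runs. Empty runs are dropped; then the first letters agree,
    being the value at time [0], and cutting the longer first run produces a common run to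
    cancel. *)
Lemma ach_ev s s' P Q g : pos s -> pos s' -> ev n s = ev n s' -> incr P ->
  ach s P Q g -> ach s' P Q g.
Proof.
have [k] := ubnP (size s + size s')%N.
elim: k s s' P g => // k IH [|[a t] s] [|[b t'] s'] P g //=; rewrite ltnS => sk.
- move=> _ /andP[/= t0 p'] E iP A; have [bn|nb] := ltnP b n.
    by have := ev_pos_len s' bn t0; rewrite -E ev_nil /= ltxx.
  apply/ach_skip => //; apply: (IH [::]) => //.
  by rewrite E ev_cons nrun_out // tcat0w.
- move=> /andP[/= t0 p'] _ E iP A; have [bn|nb] := ltnP a n.
    by have := ev_pos_len s bn t0; rewrite E ev_nil /= ltxx.
  apply: (IH s [::]) => //.
    by rewrite -E ev_cons nrun_out // tcat0w.
  by move/(ach_skip _ _ _ _ iP nb): A.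
move=> /andP[/= t0 ps] /andP[/= t'0 ps'] E iP A.
have [an|na] := ltnP a n; last first.
  apply: (IH s ((b, t') :: s')) => //; rewrite /= ?t'0 //.
    by rewrite -E ev_cons nrun_out // tcat0w.
  by move/(ach_skip _ _ _ _ iP na): A.
have [bn|nb] := ltnP b n; last first.
  apply/(ach_skip _ _ _ _ iP nb).
  apply: (IH ((a, t) :: s) s') => //; rewrite /= ?t0 //; first by lia.
  by rewrite E ev_cons nrun_out // tcat0w.
have ab : a = b.
  apply: insub_inj => //.
  by rewrite -(ev_at0 s an t0) -(ev_at0 s' bn t'0) E.
subst b; case: (ltgtP t t') => tt.
- apply/(ach_cat _ [:: (a, t')] s') => //.
  apply/(ach_cat _ [:: (a, t')] s') => //=.
  have -> : t' = t + (t' - t) by rewrite addrC subrK.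
  apply/ach_merge; [exact: ltW | by rewrite subr_ge0 ltW |].
  case: A => S [h [iS PS A gh]]; exists S, h; split => //.
  apply: (IH s) => //; rewrite /= ?subr_gt0 ?tt //.
  move: E; rewrite !ev_cons /=.
  have {1}-> : t' = t + (t' - t) by rewrite addrC subrK.
  rewrite -nrunD ?ltW ?subr_gt0 // -tcatA; exact: tcat_inj.
- have {}A : ach ((a, t') :: (a, t - t') :: s) P Q g.
    apply/ach_merge; [exact: ltW | by rewrite subr_ge0 ltW |].
    by rewrite addrC subrK.
  case: A => S [h [iS PS A gh]]; exists S, h; split => //.
  apply: (IH ((a, t - t') :: s)) => //; rewrite /= ?subr_gt0 ?tt //.
    by rewrite addSnnS.
  move: E; rewrite !ev_cons /=.
  have {1}-> : t = t' + (t - t') by rewrite addrC subrK.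
  rewrite -nrunD ?ltW ?subr_gt0 // -tcatA; exact: tcat_inj.
subst t'; case: A => S [h [iS PS A gh]]; exists S, h; split => //.
apply: (IH s) => //; first by lia.
by move: E; rewrite !ev_cons; exact: tcat_inj.
Qed.

Lemma aeq_ev s s' : pos s -> pos s' -> ev n s = ev n s' -> aeq s s'.
Proof. by move=> ps ps' E P Q g iP iQ; split; apply: ach_ev. Qed.

Lemma ev_filter s : ev n [seq q <- s | (q.1 < n)%N] = ev n s.
Proof.
elim: s => //= x s IH; rewrite ev_cons; case: ltnP => xn.
  by rewrite ev_cons IH.
by rewrite IH nrun_out // tcat0w.
Qed.

Definition flist w d m := [seq q <- glist w d m | (q.1 < n)%N].

Lemma flist_mem w d m a : a \in map fst (flist w d m) ->
  exists p (c : 'I_n), [/\ (p < m)%N, w (d p) = Some c & a = c].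
Proof.
case/mapP => x; rewrite mem_filter => /andP[xn /mapP[p]].
rewrite mem_iota add0n => /andP[_ pm] xE aE; subst x a.
by move: xn; rewrite /= /ent; case E: (w _) => [c|]; rewrite ?ltnn //; exists p, c.
Qed.

Lemma flist_pos w (d : nat -> R) m : (forall p, (p < m)%N -> d p < d p.+1) ->
  pos (flist w d m).
Proof.
move=> dS; apply/allP => x; rewrite mem_filter => /andP[_ /mapP[p]].
by rewrite mem_iota add0n => /andP[_ /dS dp] -> /=; rewrite subr_gt0.
Qed.

Lemma flist_sorted w (d : nat -> R) m :
  (forall p, (p < m)%N -> d p < d p.+1) -> timed_row w ->
  sorted leq (map fst (flist w d m)).
Proof.
move=> dS rw; elim: m dS => // m IH dS.
rewrite /flist /glist iotaSr map_rcons filter_rcons /= -/(flist w d m).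
have {}IH := IH (fun p pm => dS p (ltnW pm)).
case: ifP => // wn; rewrite map_rcons -cats1 sorted_cat_leq IH allrel1r /=.
apply/allP => a /flist_mem[p [c [pm wp ->]]].
move: wn; rewrite /ent add0n; case wm: (w (d m)) => [e|]; rewrite ?ltnn // => _.
have H : forall q, (q <= m)%N -> d q <= d m.
  elim: m dS {IH wm pm} => [|m IH] dS q; first by rewrite leqn0 => /eqP->.
  rewrite leq_eqVlt => /orP[/eqP->//|]; rewrite ltnS => qm.
  apply: le_trans (IH _ q qm) (ltW (dS m _)) => //.
  by move=> p' p'm; apply: dS; exact: ltnW.
by apply: rw wp wm; apply: H; exact: ltnW.
Qed.

Lemma exists_runs w : exists s, pos s /\ ev n s = w.
Proof.
have [d [m [_ dS H]]] := common_grid [:: w].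
exists (flist w d m); split; first exact: flist_pos.
by rewrite ev_filter -(H 0%N).
Qed.

(** In rows, the left limit of [u] is its largest letter and [v 0] is the smallest letter of [v], so
    the comparison at the junction spreads to all pairs. *)
Lemma last_lt_firstP u v (x y : R) (a b : 'I_n) : timed_row u -> timed_row v ->
  last_lt_first u v -> u x = Some a -> v y = Some b -> (a < b)%N.
Proof.
move=> ru rv [a' [b' [ua vb ab]]] uxa vyb.
have /andP[x0 xu] := tfun_Some uxa; have /andP[y0 _] := tfun_Some vyb.
have b'b : (b' <= b)%N by exact: rv vb vyb.
have [z [xz uz]] : exists z : R, x <= z /\ u z = Some a'.
  have N : \forall z \near (tlen u)^'-, x <= (z : R) /\ u z = Some a'.
    near=> z; split; last by near: z.
    by near: z; exact: nbhs_left_ge.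
  exact: (@filter_ex _ _ (at_left_proper_filter (tlen u)) _ N).
have aa' : (a <= a')%N by exact: ru uxa uz.
exact: leq_ltn_trans aa' (leq_trans ab b'b).
Unshelve. all: by end_near. Qed.

Lemma timed_row_l u v : timed_row (tcat u v) -> timed_row u.
Proof. by move=> r x y a b xy ua ub; apply: (r x y) => //; exact: tcat_l. Qed.

Lemma timed_row_r u v : timed_row (tcat u v) -> timed_row v.
Proof.
move=> r x y a b xy va vb.
have /andP[x0 _] := tfun_Some va; have /andP[y0 _] := tfun_Some vb.
by apply: (r (tlen u + x) (tlen u + y)); rewrite ?lerD2l ?tcat_r.
Qed.

Lemma flist_sorted2 u v (d : nat -> R) m :
  (forall p, (p < m)%N -> d p < d p.+1) -> timed_row (tcat u v) ->
  sorted leq (map fst (flist u d m ++ flist v d m)).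
Proof.
move=> dS r; rewrite map_cat sorted_cat_leq.
apply/and3P; split; [|apply: flist_sorted => //|].
- by apply: flist_sorted => //; exact: timed_row_l r.
- exact: timed_row_r r.
apply/allrelP => a b /flist_mem[p [c [_ uc ->]]] /flist_mem[q [c' [_ vc ->]]].
exact: timed_row_catP r uc vc.
Qed.

(** Equal lengths make both rows occupy the same cells of the grid, so their letters pair up cell by
    cell. *)
Lemma flist_triples u v (d : nat -> R) m : d 0%N = 0 ->
    (forall p, (p < m)%N -> d p < d p.+1) ->
    timed_row u -> timed_row v -> tlen u = tlen v -> last_lt_first u v ->
  exists tr, [/\ separated tr, low tr = flist u d m & high tr = flist v d m].
Proof.
move=> d0 dS ru rv uv lt.
have uvn x : (ent u x < n)%N = (ent v x < n)%N by rewrite !ent_lt uv.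
exists [seq (ent u (d p), ent v (d p), d p.+1 - d p) |
         p <- [seq p <- iota 0 m | (ent u (d p) < n)%N]].
split; last first.
- rewrite /high -map_comp /flist /glist filter_map.
  by congr map; apply: eq_filter => p; rewrite /= uvn.
- by rewrite /low -map_comp /flist /glist filter_map.
split.
- apply/allP => x /mapP[p]; rewrite mem_filter mem_iota add0n => /andP[_ pm] ->.
  by rewrite /= subr_ge0 ltW // dS //; case/andP: pm.
- apply/allP => x /mapP[p]; rewrite mem_filter => /andP[pn _] ->.
  by rewrite /= -uvn.
move=> x y /mapP[p]; rewrite mem_filter => /andP[pn _] -> /mapP[q].
rewrite mem_filter uvn => /andP[qn _] -> /=; move: pn qn.
rewrite /ent; case up: (u _) => [a|]; rewrite ?ltnn // => _.
case vq: (v _) => [b|]; rewrite ?ltnn // => _.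
exact: last_lt_firstP lt up vq.
Qed.

Lemma timed_knuth_aeq v1 v2 : timed_knuth v1 v2 ->
  exists s1 s2, [/\ pos s1 /\ pos s2, ev n s1 = v1, ev n s2 = v2 & aeq s1 s2].
Proof.
have grid x y z : exists (d : nat -> R) m, [/\ d 0%N = 0,
    forall p, (p < m)%N -> d p < d p.+1 &
    [/\ ev n (flist x d m) = x, ev n (flist y d m) = y &
        ev n (flist z d m) = z]].
  have [d [m [d0 dS H]]] := common_grid [:: x; y; z].
  exists d, m; split => //; split; rewrite ev_filter;
    [exact/esym/(H 0%N)|exact/esym/(H 1%N)|exact/esym/(H 2%N)].
case=> x y z rx ry rz rxyz leq_len lt;
  have [d [m [d0 dS [xE yE zE]]]] := grid x y z;
  have pE w := @flist_pos w d m dS.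
- have [tr [sep lE hE]] := flist_triples d0 dS ry rz (esym leq_len) lt.
  exists (flist x d m ++ high tr ++ low tr), (high tr ++ flist x d m ++ low tr).
  rewrite lE hE !ev_cat xE yE zE !tcatA; split => //.
    by rewrite !pos_cat !pE.
  rewrite -lE -hE; apply: aeq_kappa1 => //.
    by rewrite lE; apply: flist_sorted2 => //; exact: timed_row_l rxyz.
  by rewrite hE; apply: flist_sorted.
- have [tr [sep lE hE]] := flist_triples d0 dS rx ry leq_len lt.
  exists (high tr ++ low tr ++ flist z d m), (high tr ++ flist z d m ++ low tr).
  rewrite lE hE !ev_cat xE yE zE !tcatA; split => //.
    by rewrite !pos_cat !pE.
  rewrite -lE -hE; apply: aeq_kappa2 => //.
    by rewrite lE; apply: flist_sorted.
  rewrite hE; apply: flist_sorted2 => //.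
  by move: rxyz; rewrite -tcatA; exact: timed_row_r.
Qed.

Lemma knuth_equiv_aeq w w' s s' : knuth_equiv w w' -> pos s -> pos s' ->
  ev n s = w -> ev n s' = w' -> aeq s s'.
Proof.
move=> E; elim: E s s' => {w w'}.
- move=> _ _ [p v1 v2 q /timed_knuth_aeq[s1 [s2 [[p1 p2] <- <- A]]]] s s' ps ps'.
  have [sp [psp <-]] := exists_runs p; have [sq [psq <-]] := exists_runs q.
  rewrite -!ev_cat -!catA => E1 E2.
  apply: (@aeq_trans _ _ (sp ++ s1 ++ sq)).
    by apply: aeq_ev => //; rewrite !pos_cat; apply/and3P.
  apply: (@aeq_trans _ _ (sp ++ s2 ++ sq)).
    by apply/aeq_cat/aeq_cat => //; exact: aeq_refl.
  by apply: aeq_ev => //; rewrite !pos_cat; apply/and3P.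
- by move=> w s s' ps ps' E1 E2; apply: aeq_ev; rewrite // E1.
- by move=> w w' _ IH s s' ps ps' E1 E2; apply/aeq_sym/IH.
- move=> u v w _ IH1 _ IH2 s s' ps ps' E1 E2.
  have [r [pr rE]] := exists_runs v.
  by apply: (@aeq_trans _ _ r); [apply: IH1 | apply: IH2].
Qed.

End Invariance.

(** * Gains along a tableau *)

Section GridTableau.
Variables (R : realType) (n : nat).
Implicit Types (S P Q : nat -> nat) (g : R).
Local Notation ach := (ach n).
Local Notation aeq := (aeq n).
Local Notation hit := (hit n).

(* [e i p] is the letter of row [i] on the cell [p], of width [t p]; a value
   [>= n] stands for a cell beyond the end of the row. *)
Variables (t : nat -> R) (m : nat).
Implicit Types e : nat -> nat -> nat.

Definition rowl e i := [seq (e i p, t p) | p <- index_iota 0 m].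

Fixpoint tabl e l : seq (nat * R) :=
  if l is l'.+1 then rowl e l' ++ tabl e l' else [::].

Definition column_strict e := forall i p, (p < m)%N -> (e i p < e i.+1 p)%N.
Definition row_weak e := forall i p q, (p <= q < m)%N -> (e i p <= e i q)%N.

Definition below e i a : R := \sum_(0 <= p < m) t p *+ (e i p < a).

(** Endpoints with [k] active strands; the others are parked at [n + j], outside the alphabet, where
    they hit nothing. *)
Definition bot k j := if (j < k)%N then j else (n + j)%N.
Definition top k a j := if (j < k)%N then (a - k + j)%N else (n + j)%N.

Lemma ach_path (F : nat -> nat -> nat) (H : nat -> bool) (c : nat -> nat) q r P Q :
    (forall p, (q <= p < r)%N ->
       [/\ incr (F p), sle P (F p), sle (F p) Q & H p -> hit (F p) (c p)]) ->
    (forall p p', (q <= p <= p')%N -> (p' < r)%N -> sle (F p) (F p')) ->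
    sle P Q ->
  ach [seq (c p, t p) | p <- index_iota q r] P Q (\sum_(q <= p < r) t p *+ H p).
Proof.
have [k] := ubnP (r - q); elim: k q P => // k IH q P; rewrite ltnS => rk HF HM PQ.
have [rq|qr] := leqP r q.
  by rewrite big_geq // /index_iota (eqP (rq : (r - q == 0)%N)).
rewrite big_ltn // /index_iota (_ : r - q = (r - q.+1).+1)%N /=; last by lia.
have [iF PF FQ hF] := HF q (ltac:(lia)).
exists (F q), (\sum_(q.+1 <= p < r) t p *+ H p); split => //.
  apply: IH => // [|p qp|p p' qp p'r]; first by lia.
    have [iF' PF' FQ' hF'] := HF p (ltac:(lia)); split => //.
    by apply: HM; lia.
  by apply: HM; lia.
case: (H q) hF => [hF|_] /=; rewrite ?mulr1n ?mulr0n ?add0r; last by left.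
by right; split; [exact: hF | rewrite addrC].
Qed.

(** * The maximal gain from [bot k] to [top k a] *)

Section Bounds.
Variables (e : nat -> nat -> nat) (k a : nat).
Hypotheses (ecol : column_strict e) (erow : row_weak e) (ka : (k <= a <= n)%N).
Hypothesis t_ge0 : forall p, (p < m)%N -> 0 <= t p.

Lemma entry_ge i p : (p < m)%N -> (i <= e i p)%N.
Proof. by move=> pm; elim: i => // i IH; apply: leq_ltn_trans IH (ecol i pm). Qed.

Lemma entry_lt i i' p : (p < m)%N -> (i < i')%N -> (e i p < e i' p)%N.
Proof.
move=> pm; elim: i' => // i' IH; rewrite ltnS leq_eqVlt => /orP[/eqP->|/IH H].
  exact: ecol.
exact: ltn_trans H (ecol _ pm).
Qed.

Let stage i j := if (j < i)%N then bot k j else top k a j.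

(* Strand [i] travels along row [i], while the strands below it wait at the
   bottom and the strands above it have already reached the top. *)
Lemma below_ach_row i :
  ach (rowl e i) (stage i.+1) (stage i) (below e i a *+ (i < k)).
Proof.
have ST : sle (stage i.+1) (stage i).
  by move=> j; rewrite /stage /bot /top; do ?case: ifPn; lia.
have iS : incr (stage i) by move=> j; rewrite /stage /bot /top; do ?case: ifPn; lia.
have [ik|ki] := ltnP i k; last first.
  rewrite mulr0n.
  have := @ach_path (fun=> stage i) xpred0 (e i) 0 m (stage i.+1) (stage i).
  rewrite big1 => [|p _]; last by rewrite mulr0n.
  by apply => // p _; split.
rewrite mulr1n.
(* Strand [i] follows the entries of row [i] until it reaches its target [a - k + i]. *)
pose F p j := if j == i then minn (e i p) (a - k + i)%N else
  if (j < i)%N then bot k j else top k a j.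
apply: (@ach_path F) => //.
- move=> p pm; have {}pm : (p < m)%N by lia.
  have ei := entry_ge i pm; split.
  + move=> j; rewrite /F /bot /top.
    have [ji|ji] := eqVneq j i; have [ji'|ji'] := eqVneq j.+1 i;
      do ?case: ifPn; lia.
  + move=> j; rewrite /F /stage /bot /top.
    by have [ji|ji] := eqVneq j i; do ?case: ifPn; lia.
  + move=> j; rewrite /F /stage /bot /top.
    by have [ji|ji] := eqVneq j i; do ?case: ifPn; lia.
  + move=> ea; split; first by lia.
    have [le|gt] := leqP (e i p) (a - k + i).
      by exists i; rewrite /F eqxx; apply/minn_idPl.
    (* Letters between the target of strand [i] and [a] are occupied by later strands, already at
       the top, so they are hit as well. *)
    exists (e i p - (a - k))%N; rewrite /F /top.
    by case: eqP; do ?case: ifPn; lia.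
- move=> p p' pp p'm j; rewrite /F; case: eqP => // _.
  by have := @erow i p p'; rewrite p'm; case/andP: pp => _ -> /(_ isT); lia.
Qed.

Lemma below_ach l : ach (tabl e l) (bot k) (top k a)
  (\sum_(0 <= i < l) below e i a *+ (i < k)).
Proof.
have bs i : sle (bot k) (stage i).
  by move=> j; rewrite /stage /bot /top; do ?case: ifPn; lia.
have iS i : incr (stage i).
  by move=> j; rewrite /stage /bot /top; do ?case: ifPn; lia.
suff : ach (tabl e l) (stage l) (top k a) (\sum_(0 <= i < l) below e i a *+ (i < k)).
  by apply: ach_le.
elim: l => [|l IH] /=; first by rewrite big_nil.
apply/ach_cat => //; exists (stage l); do 2!eexists.
split; [exact: iS|exact: below_ach_row|exact: IH|].
by rewrite big_nat_recr //= addrC.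
Qed.

Definition above S x := (\sum_(0 <= j < k) (x <= S j))%N.
Definition height l i p := (\sum_(i <= i' < l) (e i' p < a))%N.

(* Upper bound for the gain along the rows [>= i] of a chain ending at [S]: in
   each column, a strand hits at most one entry, and only entries smaller than
   [a] are hit. *)
Definition potential l i S : R :=
  \sum_(0 <= p < m) t p *+ minn (above S (e i p)) (height l i p).

Lemma above_le S S' x : sle S S' -> (above S x <= above S' x)%N.
Proof.
move=> SS; apply: leq_sum => j _.
by case: (leqP x (S j)) => // xS; rewrite (leq_trans xS (SS j)).
Qed.

Lemma above_lt S x y : (exists2 j, (j < k)%N & S j = x) -> (x < y)%N ->
  (above S y < above S x)%N.
Proof.
case=> j jk Sj xy; rewrite /above !big_mkord (bigD1 (Ordinal jk)) //=.
rewrite [X in (_ < X)%N](bigD1 (Ordinal jk)) //= Sj leqnn [(y <= x)%N]leqNgt xy /=.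
rewrite add0n add1n ltnS; apply: leq_sum => i _.
by case: (leqP y (S i)) => // yS; rewrite (leq_trans (ltnW xy) yS).
Qed.

Lemma above_anti S x y : (x <= y)%N -> (above S y <= above S x)%N.
Proof.
move=> xy; apply: leq_sum => j _.
by case: (leqP y (S j)) => // yS; rewrite (leq_trans xy yS).
Qed.

(** A hit raises both bounds by one: the hitting strand is counted at [e i p] but not at the larger
    entry [e i.+1 p], and [e i p < a] since active strands end below [a]. *)
Lemma potential_cell l i p S0 S S' : (i < l)%N -> (p < m)%N ->
    sle (bot k) S0 -> sle S0 S -> sle S S' -> sle S' (top k a) ->
  (minn (above S0 (e i.+1 p)) (height l i.+1 p) + `[<hit S (e i p)>] <=
   minn (above S' (e i p)) (height l i p))%N.
Proof.
move=> il pm bS0 S0S SS' S'top.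
have A1 := above_le (e i.+1 p) S0S; have A2 := above_le (e i p) SS'.
have A3 := @above_anti S _ _ (ltnW (ecol i pm)).
have hE : height l i p = ((e i p < a) + height l i.+1 p)%N.
  by rewrite /height big_ltn.
case: asboolP => [[en [j Sj]]|_]; last by rewrite hE; lia.
have jk : (j < k)%N.
  rewrite ltnNge; apply/negP => kj; have := bS0 j; have := S0S j.
  by rewrite /bot ltnNge kj /=; lia.
have ea : (e i p < a)%N.
  by rewrite -Sj; have := SS' j; have := S'top j; rewrite /top jk; lia.
have A4 := @above_lt S _ _ (ex_intro2 _ _ j jk Sj) (ecol i pm).
by rewrite hE ea; lia.
Qed.

Lemma potential_row l i S S' g : (i < l)%N -> sle (bot k) S ->
    sle S' (top k a) -> ach (rowl e i) S S' g ->
  g <= potential l i S' - potential l i.+1 S.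
Proof.
move=> il bS S'top; rewrite /potential /rowl.
(* Induction on the remaining cells: the potential of the row above stays evaluated at the initial
   [S], while the chain has moved on to [S1]. *)
suff : forall q S1, sle S S1 ->
   ach [seq (e i p, t p) | p <- index_iota q m] S1 S' g ->
   g <= \sum_(q <= p < m) t p *+ minn (above S' (e i p)) (height l i p) -
     \sum_(q <= p < m) t p *+ minn (above S (e i.+1 p)) (height l i.+1 p).
  by move/(_ 0%N S (sle_refl _)).
move=> q; have [r] := ubnP (m - q); elim: r q g => // r IH q g.
rewrite ltnS => mr S1 SS1; have [mq|qm] := leqP m q.
  by rewrite !big_geq // /index_iota (eqP (mq : (m - q == 0)%N)) subr0 => -[].
rewrite !(big_ltn qm) /index_iota (_ : m - q = (m - q.+1).+1)%N /=; last by lia.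
case=> T [g' [iT S1T A gg]]; have TS' := ach_sle A.
have {A} := IH q.+1 g' (ltac:(lia)) T (sle_trans SS1 S1T) A.
have := potential_cell il qm bS (sle_trans SS1 S1T) TS' S'top.
have tq := t_ge0 qm; move: (minn _ _) (minn _ _) => y x xy.
have : t q *+ (x + `[<hit T (e i q)>]) <= t q *+ y by exact: ler_wpMn2l.
rewrite mulrnDr; case: gg => [gg|[hT gg]].
  have : 0 <= t q *+ `[<hit T (e i q)>] by exact: mulrn_wge0.
  by lra.
by rewrite (asboolT hT) mulr1n; lra.
Qed.

Lemma potential_tabl l l' S g : (l' <= l)%N -> sle (bot k) S -> incr S ->
  ach (tabl e l') S (top k a) g ->
  g <= potential l 0 (top k a) - potential l l' S.
Proof.
elim: l' S g => [|l' IH] S g ll bS iS /=.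
  case=> ST g0; suff : potential l 0 S <= potential l 0 (top k a) by lra.
  apply: ler_sum_nat => p /andP[_ pm]; apply: ler_wpMn2l; first exact: t_ge0.
  by have := above_le (e 0%N p) ST; lia.
case/ach_cat => // T [g1 [g2 [iT A1 A2 gg]]].
have bT := sle_trans bS (ach_sle A1).
have := IH T g2 (ltnW ll) bT iT A2.
have := potential_row ll bS (ach_sle A2) A1.
by lra.
Qed.

Lemma ach_below l g : (k <= l)%N -> ach (tabl e l) (bot k) (top k a) g ->
  g <= \sum_(0 <= i < k) below e i a.
Proof.
move=> kl A.
have ib : incr (bot k) by move=> j; rewrite /bot; do ?case: ifPn; lia.
have := potential_tabl (leqnn l) (sle_refl _) ib A.
have -> : potential l l (bot k) = 0.
  by apply: big1 => p _; rewrite /height big_geq // minn0 mulr0n.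
rewrite subr0 => /le_trans; apply; rewrite /below exchange_big /=.
apply: ler_sum_nat => p /andP[_ pm]; rewrite sumrMnr.
apply: ler_wpMn2l; first exact: t_ge0.
(* If [e k p < a], all first [k] entries of the column are below [a] and at most [k] strands count;
   otherwise only the first [k] rows contribute to the height. *)
have [ea|ea] := ltnP (e k p) a.
  rewrite geq_min; apply/orP; left; apply: leq_trans (_ : k <= _)%N.
    rewrite /above; apply: leq_trans (_ : \sum_(0 <= j < k) 1 <= _)%N.
      by apply: leq_sum => j _; exact: leq_b1.
    by rewrite sum_nat_const_nat subn0 muln1.
  rewrite -[X in (X <= _)%N](_ : \sum_(0 <= j < k) 1 = k)%N; last first.
    by rewrite sum_nat_const_nat subn0 muln1.
  rewrite big_nat [X in (_ <= X)%N]big_nat; apply: leq_sum => i /andP[_ ik].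
  by rewrite (ltn_trans (entry_lt pm ik) ea).
rewrite geq_min; apply/orP; right; rewrite /height (big_cat_nat (leq0n k) kl) //=.
rewrite [X in (_ + X)%N]big_nat [X in (_ + X)%N]big1 ?addn0 // => i /andP[ki _].
apply/eqP; rewrite eqb0 -leqNgt (leq_trans ea) //.
move: ki; rewrite leq_eqVlt => /orP[/eqP->//|/(entry_lt pm)/ltnW//].
Qed.

End Bounds.

(** Each side is the maximal gain from [bot k] to [top k a] over its tableau, and [aeq] preserves
    it. *)
Lemma below_sum_eq e e' l k a : column_strict e -> row_weak e ->
    column_strict e' -> row_weak e' -> (forall p, (p < m)%N -> 0 <= t p) ->
    (n <= l)%N -> (k <= a <= n)%N -> aeq (tabl e l) (tabl e' l) ->
  \sum_(0 <= i < k) below e i a = \sum_(0 <= i < k) below e' i a.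
Proof.
move=> c1 r1 c2 r2 t0 nl ka E.
have kl : (k <= l)%N by lia.
have ib : incr (bot k) by move=> j; rewrite /bot; do ?case: ifPn; lia.
have it : incr (top k a) by move=> j; rewrite /top; do ?case: ifPn; lia.
have sumE f : \sum_(0 <= i < l) below f i a *+ (i < k) = \sum_(0 <= i < k) below f i a.
  rewrite (big_cat_nat (leq0n k) kl) //= [X in _ + X]big_nat [X in _ + X]big1 ?addr0.
    by apply: eq_big_nat => i /andP[_ ->].
  by move=> i /andP[ki _]; rewrite ltnNge ki.
have A1 := below_ach c1 r1 ka l; have A2 := below_ach c2 r2 ka l.
rewrite !sumE in A1 A2; move/(E _ _ _ ib it) in A1; move/(E _ _ _ ib it) in A2.
by apply/eqP; rewrite eq_le (ach_below c2 ka t0 kl A1) (ach_below c1 ka t0 kl A2).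
Qed.

(** For [i < a], subtract the sums over [i] rows from those over [i.+1] rows; for [a <= i] both
    sides vanish, as row [i] has entries at least [i]. *)
Lemma below_eq e e' l i a : column_strict e -> row_weak e ->
    column_strict e' -> row_weak e' -> (forall p, (p < m)%N -> 0 <= t p) ->
    (n <= l)%N -> (a <= n)%N -> aeq (tabl e l) (tabl e' l) ->
  below e i a = below e' i a.
Proof.
move=> c1 r1 c2 r2 t0 nl an E.
have [ia|ai] := ltnP i a.
  have := @below_sum_eq e e' l i.+1 a c1 r1 c2 r2 t0 nl _ E.
  rewrite !big_nat_recr //= (@below_sum_eq e e' l i a) //; last by lia.
  by move=> H; apply: (addrI _ (H _)); lia.
rewrite /below !big_nat !big1 // => p /andP[_ pm]; apply/eqP; rewrite mulrn_eq0 eqb0 -leqNgt.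
  by rewrite (leq_trans ai) // entry_ge.
by rewrite (leq_trans ai) // entry_ge.
Qed.

(** In a weakly increasing row the cells with entry [< a] form an initial segment, which its width
    determines because cells have positive width. *)
Lemma below_inj e e' i a p : row_weak e -> row_weak e' ->
    (forall p, (p < m)%N -> 0 < t p) -> below e i a = below e' i a ->
  (p < m)%N -> (e i p < a)%N -> (e' i p < a)%N.
Proof.
move=> r1 r2 t0 E pm ea; rewrite ltnNge; apply/negP => ae'.
have : \sum_(q < m) (t q *+ (e i q < a) - t q *+ (e' i q < a)) = 0.
  by rewrite sumrB; move: E; rewrite /below !big_mkord => ->; rewrite subrr.
move/eqP; rewrite psumr_eq0 => [|q _].
  move/allP => /(_ (Ordinal pm) (mem_index_enum _)) /=.
  by rewrite ea ltnNge ae' /= mulr0n subr0 gt_eqF ?t0.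
have tq := ltW (t0 q (ltn_ord q)).
have [qp|pq] := leqP q p.
  have -> : (e i q < a)%N by apply: leq_ltn_trans ea; apply: r1; rewrite qp.
  by case: (_ < _)%N; rewrite ?subrr ?subr0.
have -> : (e' i q < a)%N = false.
  by apply/negbTE; rewrite -leqNgt (leq_trans ae') // r2 // ltnW //=.
by rewrite subr0 mulrn_wge0.
Qed.

(** Entries [>= n] may differ between [e] and [e'] but denote empty cells, so the evaluated rows are
    compared rather than the entries. *)
Lemma ev_row_eq e e' i : row_weak e -> row_weak e' ->
    (forall p, (p < m)%N -> 0 < t p) ->
    (forall a, (a <= n)%N -> below e i a = below e' i a) ->
  ev n (rowl e i) = ev n (rowl e' i).
Proof.
move=> r1 r2 t0 E; rewrite /ev /rowl !big_map; apply: eq_big_nat => p /andP[_ pm] /=.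
have [en|ne] := ltnP (e i p) n; last first.
  rewrite !nrun_out // leqNgt; apply/negP => e'n.
  have := @below_inj e' e i _ p r2 r1 t0 (esym (E _ (leqnn n))) pm e'n.
  by rewrite ltnNge ne.
have e'e : (e' i p < (e i p).+1)%N.
  exact: (@below_inj e e' i _ p r1 r2 t0 (E _ en) pm).
have ee' : (e i p < (e' i p).+1)%N.
  apply: (@below_inj e' e i _ p r2 r1 t0 (esym (E _ _)) pm) => //.
  by apply: leq_trans en; exact: e'e.
have -> // : e i p = e' i p.
by apply/eqP; rewrite eqn_leq; move: ee' e'e; rewrite !ltnS => -> ->.
Qed.

End GridTableau.

(** * Knuth equivalent tableaux coincide *)

Section Uniqueness.
Variables (R : realType) (n : nat).
Implicit Types (u v w : timed_word R n) (us : seq (timed_word R n)).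

(** Indexing from the last row read and padding with empty rows lets two tableaux share the number
    [l] of rows. *)
Lemma big_tcat_rev us l : (size us <= l)%N ->
  \big[@tcat R n/tempty]_(u <- us) u =
  \big[@tcat R n/tempty]_(i <- rev (iota 0 l)) nth tempty (rev us) i.
Proof.
move=> sl; rewrite -(big_map (nth tempty (rev us)) xpredT id) map_rev.
have -> : map (nth tempty (rev us)) (iota 0 l) = rev us ++ nseq (l - size us) tempty.
  apply: (@eq_from_nth _ tempty) => [|i].
    by rewrite size_map size_iota size_cat size_nseq size_rev subnKC.
  rewrite size_map size_iota => il; rewrite (nth_map 0%N) ?size_iota //.
  rewrite nth_iota // add0n nth_cat; case: ltnP => // si.
  by rewrite nth_default // nth_nseq if_same.
rewrite rev_cat big_cat revK rev_nseq /= big_nseq.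
by rewrite (_ : iter _ _ _ = tempty) ?tcat0w //; elim: (_ - _)%N => //= k ->; rewrite tcatw0.
Qed.

Lemma ev_tabl (t : nat -> R) m e l : ev n (tabl t m e l) =
  \big[@tcat R n/tempty]_(i <- rev (iota 0 l)) ev n (rowl t m e i).
Proof.
elim: l => [|l IH] /=; first by rewrite big_nil ev_nil.
by rewrite ev_cat IH -/(iota 0 l.+1) iotaSr rev_rcons big_cons.
Qed.

Lemma tableau_nth us : (forall i, (i.+1 < size us)%N ->
    row_lt (nth tempty us i.+1) (nth tempty us i)) ->
  forall i, row_lt (nth tempty (rev us) i) (nth tempty (rev us) i.+1).
Proof.
move=> H i; have [si|si] := ltnP i.+1 (size us); last first.
  rewrite [X in row_lt _ X]nth_default ?size_rev //; split=> [|x a b].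
    exact: tlen_ge0.
  by move=> /andP[x0]; rewrite ltNge x0.
rewrite !nth_rev ?(ltnW si) //.
have -> : (size us - i.+1 = (size us - i.+2).+1)%N by lia.
by apply: H; lia.
Qed.

(* Beyond the end of row [i] we use the pairwise distinct values [n + i], so
   that columns are strictly increasing throughout. *)
Definition entry us (d : nat -> R) i p :=
  let c := ent (nth tempty (rev us) i) (d p) in
  if (c < n)%N then c else (n + i)%N.

Lemma ev_entry us (d : nat -> R) m i :
  ev n (rowl (fun p => d p.+1 - d p) m (entry us d) i) =
  ev n (glist (nth tempty (rev us) i) d m).
Proof.
rewrite /ev /rowl /glist /index_iota subn0 !big_map; apply: eq_bigr => p _ /=.
by rewrite /entry; case: ltnP => // nc; rewrite !nrun_out // leq_addr.
Qed.

Lemma entry_col us (d : nat -> R) m : (forall p, (p < m)%N -> 0 <= d p) ->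
    (forall i, row_lt (nth tempty (rev us) i) (nth tempty (rev us) i.+1)) ->
  column_strict m (entry us d).
Proof.
move=> d0 H i p pm; have [len lt] := H i; rewrite /entry; have := ent_lt (nth tempty (rev us) i.+1) (d p).
case: (ltnP (ent (nth tempty (rev us) i.+1) (d p)) n) => c1 E.
  have dp : 0 <= d p < tlen (nth tempty (rev us) i.+1) by [].
  have c0 : (ent (nth tempty (rev us) i) (d p) < n)%N.
    by rewrite ent_lt; case/andP: dp => -> /= /lt_le_trans ->.
  rewrite c0; move: c0 c1; rewrite /ent.
  case E0: (nth tempty (rev us) i (d p)) => [a|]; rewrite ?ltnn // => _.
  case E1: (nth tempty (rev us) i.+1 (d p)) => [b|]; rewrite ?ltnn // => _.
  exact: lt E0 E1.
by case: (ltnP (ent (nth tempty (rev us) i) (d p)) n); lia.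
Qed.

Lemma entry_row us (d : nat -> R) m :
    (forall p q, (p <= q < m)%N -> d p <= d q) -> (forall p, (p < m)%N -> 0 <= d p) ->
    (forall i, timed_row (nth tempty (rev us) i)) ->
  row_weak m (entry us d).
Proof.
move=> d_le d0 H i p q pq; rewrite /entry.
have pm : (p < m)%N by lia.
case: (ltnP (ent _ (d q)) n) => cq; last first.
  by case: (ltnP (ent (nth tempty (rev us) i) (d p)) n); lia.
have : (ent (nth tempty (rev us) i) (d p) < n)%N.
  move: cq; rewrite !ent_lt (d0 p pm) /= => /andP[_ dq].
  exact: le_lt_trans (d_le _ _ pq) dq.
move=> cp; rewrite cp; move: cp cq; rewrite /ent.
case Ep: (nth tempty (rev us) i (d p)) => [a|]; rewrite ?ltnn // => _.
case Eq: (nth tempty (rev us) i (d q)) => [b|]; rewrite ?ltnn // => _.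
by apply: H Ep Eq; apply: d_le.
Qed.

Lemma decomposition_row w us i : row_decomposition w us ->
  timed_row (nth tempty (rev us) i).
Proof.
case=> _ H _; have [si|si] := ltnP i (size us); last first.
  by rewrite nth_default ?size_rev // => x y a b.
by rewrite nth_rev //; apply: (H _ _).1; lia.
Qed.

Lemma tableau_uniq v v' : timed_tableau v -> timed_tableau v' ->
  knuth_equiv v v' -> v = v'.
Proof.
move=> [us [D1 L1]] [us' [D2 L2]] E.
have [d [m [d0 dS H]]] := common_grid (rev us ++ rev us').
(* [l] exceeds both numbers of rows, and [n <= l] is the condition of [below_eq]. *)
pose l := (size us + size us' + n)%N.
have d_le p q : (p <= q < m)%N -> d p <= d q.
  move=> /andP[pq qm]; elim: q pq qm => [|q IH].
    by rewrite leqn0 => /eqP->.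
  rewrite leq_eqVlt => /orP[/eqP->//|]; rewrite ltnS => /IH pq qm.
  exact: le_trans (pq (ltnW qm)) (ltW (dS _ (ltnW qm))).
have d_ge0 p : (p < m)%N -> 0 <= d p by move=> pm; rewrite -d0; apply: d_le.
have G1 i : ev n (glist (nth tempty (rev us) i) d m) = nth tempty (rev us) i.
  have [si|si] := ltnP i (size (rev us)).
    by have := H i; rewrite nth_cat si.
  rewrite [nth _ _ _]nth_default //.
  by have := H (size (rev us ++ rev us')); rewrite nth_default.
have G2 i : ev n (glist (nth tempty (rev us') i) d m) = nth tempty (rev us') i.
  have := H (size (rev us) + i)%N.
  by rewrite nth_cat ltnNge leq_addr /= addKn.
pose t p := d p.+1 - d p; pose e := entry us d; pose e' := entry us' d.
have t_gt0 p : (p < m)%N -> 0 < t p by move=> /dS; rewrite subr_gt0.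
have vE : v = ev n (tabl t m e l).
  case: (D1) => -> _ _; rewrite ev_tabl (@big_tcat_rev us l); last by rewrite /l; lia.
  by apply: eq_bigr => i _; rewrite ev_entry G1.
have vE' : v' = ev n (tabl t m e' l).
  case: (D2) => -> _ _; rewrite ev_tabl (@big_tcat_rev us' l); last by rewrite /l; lia.
  by apply: eq_bigr => i _; rewrite ev_entry G2.
have pos_tabl f k : pos (tabl t m f k).
  elim: k => //= k IH; rewrite pos_cat IH andbT.
  apply/allP => x /mapP[p]; rewrite mem_index_iota => /andP[_ pm] ->.
  exact: t_gt0.
have AE := knuth_equiv_aeq E (pos_tabl e l) (pos_tabl e' l) (esym vE) (esym vE').
have c1 : column_strict m e by apply: entry_col => //; exact: tableau_nth.
have c2 : column_strict m e' by apply: entry_col => //; exact: tableau_nth.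
have r1 : row_weak m e by apply: entry_row => // i; exact: decomposition_row D1.
have r2 : row_weak m e' by apply: entry_row => // i; exact: decomposition_row D2.
rewrite vE vE' !ev_tabl; apply: eq_bigr => i _.
apply: ev_row_eq => // a an.
by apply: (@below_eq R n t m e e' l) => //; [move=> p /t_gt0/ltW | rewrite /l; lia].
Qed.

End Uniqueness.

(** * Insertion *)

Section Existence.
Variables (R : realType) (n : nat).
Implicit Types (u v w p q : timed_word R n) (m : nat -> R) (t : R).
Implicit Types s : seq (nat * R).
Local Notation ev := (ev n).
Local Notation nrun := (nrun n).
Local Notation "u =~ v" := (knuth_equiv u v) (at level 70).

Lemma knuth_refl u : u =~ u. Proof. exact: rst_refl. Qed.

Lemma knuth_trans v u w : u =~ v -> v =~ w -> u =~ w.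
Proof. exact: rst_trans. Qed.

Lemma knuth_cat p q u v : u =~ v -> tcat (tcat p u) q =~ tcat (tcat p v) q.
Proof.
elim=> {u v} [u v [p' v1 v2 q' K]|u|u v _ IH|u v w _ IH1 _ IH2].
- have E w : tcat (tcat p (tcat (tcat p' w) q')) q =
      tcat (tcat (tcat p p') w) (tcat q' q) by rewrite !tcatA.
  by rewrite !E; apply/rst_step/KnuthStep.
- exact: rst_refl.
- exact: rst_sym.
- exact: rst_trans IH1 IH2.
Qed.

Lemma knuth_catl p u v : u =~ v -> tcat p u =~ tcat p v.
Proof. by move=> /(knuth_cat p tempty); rewrite !tcatw0. Qed.

Lemma knuth_catr q u v : u =~ v -> tcat u q =~ tcat v q.
Proof. by move=> /(knuth_cat tempty q); rewrite !tcat0w. Qed.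

Lemma knuth_rel u v : timed_knuth u v -> u =~ v.
Proof.
move=> K; move: (KnuthStep tempty tempty K); rewrite !tcat0w !tcatw0; exact: rst_step.
Qed.

Lemma last_lt_first_nrun c d t : (c < d < n)%N -> 0 < t ->
  last_lt_first (nrun c t) (nrun d t).
Proof.
move=> /andP[cd dn] t0; have cn := ltn_trans cd dn.
exists (Ordinal cn), (Ordinal dn); split => //; last first.
  by rewrite nrunE lexx t0 insubT.
rewrite tlen_nrun ?ltW //; near=> x; rewrite nrunE.
have -> : 0 <= x by near: x; exact: nbhs_left_ge.
have -> : x < t by near: x; exact: nbhs_left_lt.
by rewrite insubT.
Unshelve. all: by end_near. Qed.

Lemma ev_kappa1 x c d t : sorted leq (map fst x ++ [:: c; d]) ->
  (c < d < n)%N -> 0 <= t ->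
  ev (x ++ [:: (d, t); (c, t)]) =~ ev ((d, t) :: x ++ [:: (c, t)]).
Proof.
move=> xs cd; rewrite le_eqVlt => /orP[/eqP<-|t0].
  by rewrite ev_cons !ev_cat !ev_cons /= !nrun0 ?tcat0w; exact: knuth_refl.
rewrite ev_cons !ev_cat !ev_cons ev_nil /= tcatw0 !tcatA.
have [cn dn] : (c < n)%N /\ (d < n)%N by lia.
apply/knuth_rel/Kappa1; rewrite ?tlen_nrun ?ltW //.
- by apply: ev_row; move: xs; rewrite sorted_cat_leq => /andP[].
- exact: timed_row_nrun.
- exact: timed_row_nrun.
- rewrite -tcatA -[nrun d t]tcatw0 -(ev_nil R n) -(ev_cons n (d, t)).
  by rewrite -(ev_cons n (c, t)) -ev_cat; apply: ev_row; rewrite map_cat.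
- exact: last_lt_first_nrun.
Qed.

Lemma ev_kappa2 z c d t : sorted leq [:: c, d & map fst z] ->
  (c < d < n)%N -> 0 <= t ->
  ev [:: (d, t), (c, t) & z] =~ ev ((d, t) :: z ++ [:: (c, t)]).
Proof.
move=> zs cd; rewrite le_eqVlt => /orP[/eqP<-|t0].
  rewrite !ev_cons !ev_cat !ev_cons /= !nrun0 !tcat0w ev_nil tcatw0.
  exact: knuth_refl.
rewrite !ev_cons !ev_cat !ev_cons ev_nil /= tcatw0 !tcatA.
have [cn dn] : (c < n)%N /\ (d < n)%N by lia.
apply/knuth_rel/Kappa2; rewrite ?tlen_nrun ?ltW //.
- exact: timed_row_nrun.
- exact: timed_row_nrun.
- by apply: ev_row; move: zs => /= /andP[_ /path_sorted].
- rewrite -tcatA -(ev_cons n (d, t)) -(ev_cons n (c, t)).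
  exact: ev_row.
- exact: last_lt_first_nrun.
Qed.

(* A row is encoded by the total duration [m a] of each of its letters [a]. *)
Definition runs m i j : seq (nat * R) := [seq (a, m a) | a <- index_iota i j].

Definition row_word m := ev (runs m 0 n).

(** This is the function [U(a)] of the introductory sketch, for the row encoded by [m]. *)
Definition cum m a : R := \sum_(0 <= b < a) m b.

Definition transfer m c d t a :=
  if a == c then m c + t else if a == d then m d - t else m a.

Lemma runs_cat m i j k : (i <= j <= k)%N -> runs m i k = runs m i j ++ runs m j k.
Proof.
move=> /andP[ij jk]; rewrite /runs -map_cat /index_iota.
rewrite -{2}(subnKC ij) -iotaD; congr (map _ (iota _ _)); lia.
Qed.

Lemma runs_ltn m i j : (i < j)%N -> runs m i j = (i, m i) :: runs m i.+1 j.
Proof. by move=> ij; rewrite /runs /index_iota (_ : j - i = (j - i.+1).+1)%N //; lia. Qed.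

Lemma runs_recr m i j : (i <= j)%N -> runs m i j.+1 = runs m i j ++ [:: (j, m j)].
Proof.
move=> ij; rewrite (@runs_cat m i j) ?ij ?leqnSn // (@runs_ltn m j) //.
by rewrite /runs /index_iota subnn.
Qed.

Lemma eq_runs m m' i j : (forall a, (i <= a < j)%N -> m a = m' a) ->
  runs m i j = runs m' i j.
Proof.
by move=> E; apply/eq_in_map => a; rewrite mem_index_iota => /E ->.
Qed.

Lemma runs_fst m i j : map fst (runs m i j) = index_iota i j.
Proof. by rewrite /runs -map_comp map_id. Qed.

Lemma ev_runs0 m i j : (forall a, (i <= a < j)%N -> m a = 0) ->
  ev (runs m i j) = tempty.
Proof.
elim: j => [|j IH] H; first by rewrite /runs /index_iota ev_nil.
have [ij|ji] := leqP i j; last by rewrite /runs /index_iota (eqP ji) ev_nil.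
rewrite runs_recr // ev_cat ev_seq1 /= IH ?H ?nrun0 ?tcatw0 ?ij ?ltnSn //.
by move=> a /andP[ia aj]; rewrite H // ia ltnW.
Qed.

(** Write the row as [x d q] with a run [d] of duration [t], where [x] has letters [<= c]. Then
    [x d q c], [x d c q] and [d x c q] are equivalent by the second and the first relation. *)
Lemma bump m c d t : (c < d < n)%N -> (forall b, (c < b < d)%N -> m b = 0) ->
    0 <= m c -> 0 <= t <= m d ->
  tcat (row_word m) (nrun c t) =~ tcat (nrun d t) (row_word (transfer m c d t)).
Proof.
move=> cdn zero mc0 /andP[t0 td]; have [cd dn] := andP cdn.
have md0 : 0 <= m d - t by rewrite subr_ge0.
pose x := runs m 0 c.+1; pose q := (d, m d - t) :: runs m d.+1 n.
have rowE : row_word m = ev (x ++ (d, t) :: q).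
  rewrite /row_word (@runs_cat m 0 c.+1) ?(@runs_cat m c.+1 d n); try lia.
  rewrite (@runs_ltn m d) // !ev_cat (@ev_runs0 m c.+1 d) //.
  rewrite tcat0w /q !ev_cons /=; congr tcat.
  by rewrite tcatA nrunD // addrC subrK.
have rowE' : row_word (transfer m c d t) = ev (x ++ (c, t) :: q).
  set m' := transfer m c d t.
  have m'E a : a != c -> a != d -> m' a = m a.
    by rewrite /m' /transfer => /negPf-> /negPf->.
  rewrite /row_word (@runs_cat m' 0 c.+1) ?(@runs_cat m' c.+1 d n); try lia.
  rewrite (@runs_ltn m' d) // runs_recr // /x runs_recr //.
  have -> : runs m' 0 c = runs m 0 c by apply: eq_runs => a ac; apply: m'E; lia.
  have -> : runs m' d.+1 n = runs m d.+1 n.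
    by apply: eq_runs => a ac; apply: m'E; lia.
  have -> : m' c = m c + t by rewrite /m' /transfer eqxx.
  have -> : m' d = m d - t by rewrite /m' /transfer gtn_eqF // eqxx.
  rewrite !ev_cat (@ev_runs0 m' c.+1 d); last first.
    by move=> a acd; rewrite m'E ?zero //; lia.
  by rewrite tcat0w !ev_seq1 /= -nrunD // !ev_cons !tcatA.
rewrite rowE rowE' -(ev_seq1 n (c, t)) -ev_cat -catA /= -cat_cons.
apply: (@knuth_trans (ev (x ++ [:: (d, t), (c, t) & q]))).
  rewrite !ev_cat; apply/knuth_catl/rst_sym/ev_kappa2 => //.
  by rewrite /= leqnn (ltnW cd) runs_fst; exact: (iota_sorted d (n - d.+1).+1).
have -> : x ++ [:: (d, t), (c, t) & q] = (x ++ [:: (d, t); (c, t)]) ++ q.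
  by rewrite -catA.
have -> : tcat (nrun d t) (ev (x ++ (c, t) :: q)) =
    ev (((d, t) :: x ++ [:: (c, t)]) ++ q).
  by rewrite /= -catA [RHS]ev_cons.
rewrite !(ev_cat _ _ q); apply/knuth_catr/ev_kappa1 => //.
rewrite runs_fst sorted_cat_leq iota_sorted /= (ltnW cd) /=.
by apply/allrelP => a b; rewrite mem_index_iota !inE; lia.
Qed.

Lemma row_word_app m c t : (c < n)%N -> (forall b, (c < b < n)%N -> m b = 0) ->
    0 <= m c -> 0 <= t ->
  tcat (row_word m) (nrun c t) =
  row_word (fun a => if a == c then m c + t else m a).
Proof.
move=> cn zero m0 t0; set m' := fun a => _.
have E m1 : (forall b, (c < b < n)%N -> m1 b = 0) ->
    row_word m1 = tcat (ev (runs m1 0 c)) (nrun c (m1 c)).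
  move=> z; rewrite /row_word (@runs_cat m1 0 c.+1 n) ?runs_recr // ?cn //.
  by rewrite !ev_cat ev_seq1 (ev_runs0 z) tcatw0.
rewrite (E m) // (E m') => [|b bcn]; last by rewrite /m' gtn_eqF ?zero //; lia.
have -> : runs m' 0 c = runs m 0 c.
  by apply: eq_runs => a /andP[_ ac]; rewrite /m' ltn_eqF.
by rewrite {1}/m' eqxx -nrunD // tcatA.
Qed.

Lemma cumS m a : cum m a.+1 = cum m a + m a.
Proof. by rewrite /cum big_nat_recr. Qed.

Lemma cum_le m a b : (forall c, 0 <= m c) -> (a <= b)%N -> cum m a <= cum m b.
Proof.
move=> m0; elim: b => [|b IH]; first by rewrite leqn0 => /eqP->.
rewrite leq_eqVlt => /orP[/eqP->//|]; rewrite ltnS => /IH.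
by rewrite cumS; have := m0 b; lra.
Qed.

Lemma cum_ge0 m a : (forall c, 0 <= m c) -> 0 <= cum m a.
Proof. by move=> m0; apply: sumr_ge0. Qed.

Lemma cum_const m c a : (c < a)%N -> (forall b, (c < b < a)%N -> m b = 0) ->
  cum m a = cum m c.+1.
Proof.
elim: a => // a IH; rewrite ltnS leq_eqVlt => /orP[/eqP->//|ca] z.
rewrite cumS IH // => [|b /andP[cb ba]]; last by rewrite z // cb ltnW.
by rewrite z ?addr0 // ca ltnSn.
Qed.

Lemma cum_transfer m c d t a : (c < d)%N ->
  cum (transfer m c d t) a = cum m a + t *+ (c < a) - t *+ (d < a).
Proof.
move=> cd; elim: a => [|a IH]; first by rewrite /cum !big_geq // !mulr0n; lra.
rewrite !cumS IH /transfer !ltnS.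
by case: (ltngtP a c) => ac; case: (ltngtP a d) => ad; try lia;
  rewrite ?mulr1n ?mulr0n; subst; lra.
Qed.

Lemma cum_add m c t a :
  cum (fun b => if b == c then m c + t else m b) a = cum m a + t *+ (c < a).
Proof.
elim: a => [|a IH]; first by rewrite /cum !big_geq // mulr0n; lra.
rewrite !cumS IH !ltnS.
by case: (ltngtP a c) => ac; rewrite ?mulr1n ?mulr0n; subst; lra.
Qed.

Definition zero_row : nat -> R := fun=> 0.

(* The rows are listed from the bottom of the tableau (the longest one, which
   is read last) to the top. *)
Fixpoint rows_word (ms : seq (nat -> R)) : timed_word R n :=
  if ms is m :: ms' then tcat (rows_word ms') (row_word m) else tempty.

Fixpoint tableau_rows (ms : seq (nat -> R)) : Prop :=
  if ms is m :: ms' then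
    [/\ forall a, 0 <= m a,
        forall a, (a < n)%N -> cum (head zero_row ms') a.+1 <= cum m a &
        tableau_rows ms']
  else True.

Lemma head_ge0 ms a : tableau_rows ms -> 0 <= head zero_row ms a.
Proof. by case: ms => //= m ms []. Qed.

(** The last clause controls the growth of the first row of [ms'], in the form needed to restore the
    tableau condition against a row placed beneath it. *)
Definition inserted ms c t ms' :=
  [/\ tableau_rows ms', tcat (rows_word ms) (nrun c t) =~ rows_word ms' &
    forall a, (a <= n)%N ->
      cum (head zero_row ms') a <= cum (head zero_row ms) a \/
      (c < a)%N /\
        cum (head zero_row ms') a <= cum (head zero_row ms) c.+1 + t].

(* A run of [c] is cut into pieces, each of which bumps a run of a single letter
   [d > c] of the same duration. *)
Lemma insert_piece ms m c d t :
    (forall ms t', tableau_rows ms -> 0 <= t' -> exists ms', inserted ms d t' ms') ->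
    tableau_rows (m :: ms) -> (c < d < n)%N ->
    (forall b, (c < b < d)%N -> m b = 0) -> 0 <= t <= m d ->
  exists ms', tableau_rows (transfer m c d t :: ms') /\
    tcat (rows_word (m :: ms)) (nrun c t) =~
      rows_word (transfer m c d t :: ms').
Proof.
move=> ins [m0 mms tms] cdn zero t0d; have [cd dn] := andP cdn.
have [t0 td] := andP t0d; have [ms' [tms' K bound]] := ins ms t tms t0.
exists ms'; split; last first.
  rewrite /= -tcatA; apply: knuth_trans (knuth_catl _ (bump cdn zero (m0 c) t0d)) _.
  by rewrite tcatA; exact: knuth_catr.
split => // [a|a an].
  rewrite /transfer; have := m0 a; have := m0 c.
  by case: eqP => [_|_]; [lra|case: eqP => [_|_]; lra].
rewrite cum_transfer //.
have ct : 0 <= t *+ (c < a) - t *+ (d < a).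
  case: (ltnP d a) => [da|_]; last by rewrite mulr0n subr0 mulrn_wge0.
  by rewrite (ltn_trans cd da) subrr.
have [H|[da H]] := bound a.+1 an; first by have := mms a an; lra.
(* The new upper row has at most [cum m d + t] below [a.+1]. The new lower row has that much below
   [a]: through the added [t] of [c] if [a = d], through [m d >= t] if [a > d]. *)
have Hd := mms d dn; rewrite ltnS in da.
have ca : (c < a)%N by exact: leq_trans da.
rewrite ca mulr1n; move: da; rewrite leq_eqVlt => /orP[/eqP da|da].
  by subst a; rewrite ltnn mulr0n; lra.
rewrite da mulr1n; have := cum_le m0 da; rewrite cumS; lra.
Qed.

(** The outer induction is on [n - c], as bumped letters exceed [c]. The inner one is on [n - d],
    where [d] scans the letters above [c] and those strictly between [c] and [d] are absent from the
    row. *)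
Lemma insert_run ms c t : tableau_rows ms -> (c < n)%N -> 0 <= t ->
  exists ms', inserted ms c t ms'.
Proof.
have [k] := ubnP (n - c); elim: k ms c t => // k IHk ms c t; rewrite ltnS => nk.
case: ms => [|m ms] tms cn t0.
  (* The summand [0 +] matches the row that [row_word_app] yields from [zero_row]. *)
  exists [:: fun a => if a == c then 0 + t else 0].
  split=> /= [||a an].
  - split => // [a|a an]; first by case: ifP => _; lra.
    rewrite (@cum_add zero_row) {1 2}/cum !big1 // add0r; exact: mulrn_wge0.
  - rewrite !tcat0w -(@row_word_app zero_row c t) // {1}/row_word ev_runs0 //.
    by rewrite tcat0w; exact: knuth_refl.
  rewrite (@cum_add zero_row).
  case: (ltnP c a) => ca; last by left; rewrite mulr0n addr0.
  by right; split => //; rewrite mulr1n /cum !big1.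
have [j] := ubnP (n - c); have : (forall b, (c < b < c.+1)%N -> m b = 0) by lia.
have : (c < c.+1)%N by [].
suff : forall e, (n - e < j)%N -> (c < e)%N ->
    (forall b, (c < b < e)%N -> m b = 0) ->
    exists ms', inserted (m :: ms) c t ms'.
  by move=> H lt z nj; apply: (H c.+1) => //; lia.
elim: j m ms t tms t0 => [|j IHj] m ms t tms t0 d; first by rewrite ltn0.
rewrite ltnS => nj cd zero; have [m0 mms tms'] := tms.
have [dn|nd] := ltnP d n; last first.
  exists ((fun a => if a == c then m c + t else m a) :: ms).
  split=> [||a an].
  - split => //= [a|a an]; first by case: ifP => // _; have := m0 c; lra.
    rewrite cum_add; have := mms a an.
    have : 0 <= t *+ (c < a) by exact: mulrn_wge0.
    by lra.
  - rewrite /= -tcatA row_word_app //; first exact: knuth_refl.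
    by move=> b /andP[cb bn]; rewrite zero // cb (leq_trans bn).
  rewrite /= cum_add; case: (ltnP c a) => ca; last by left; rewrite mulr0n addr0.
  right; split => //; rewrite mulr1n (@cum_const _ c a) // => b /andP[cb ba].
  by rewrite zero // cb (leq_trans ba) // (leq_trans an).
have ins ms1 t' : tableau_rows ms1 -> 0 <= t' -> exists ms', inserted ms1 d t' ms'.
  by move=> tms1 t'0; apply: IHk => //; lia.
have cdn : (c < d < n)%N by rewrite cd.
pose s := Num.min t (m d).
have s0 : 0 <= s <= m d by rewrite /s le_min t0 m0 ge_min lexx orbT.
have st : s <= t by rewrite /s ge_min lexx.
have [ms1 [tms1 K1]] := insert_piece ins tms cdn zero s0.
have fin ms' : inserted (transfer m c d s :: ms1) c (t - s) ms' ->
    exists ms', inserted (m :: ms) c t ms'.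
  move=> [tms2 K2 bound]; exists ms'; split => // [|a an].
    have -> : nrun c t = tcat (nrun c s) (nrun c (t - s)).
      by rewrite nrunD ?subr_ge0 //; [rewrite addrC subrK | case/andP: s0].
    by rewrite tcatA; apply: knuth_trans (knuth_catr _ K1) K2.
  move: (bound a an) => /=; rewrite !cum_transfer // ltnSn mulr1n.
  rewrite [(d < c.+1)%N]ltnNge cd mulr0n subr0 => -[H|[ca H]]; last first.
    by right; split => //; lra.
  (* For [c < a <= d] the first alternative turns into the second: [cum m a] equals [cum m c.+1], no
     letter lying between, and [s <= t]. *)
  move: H; case: (ltnP c a) => ca; last first.
    by rewrite [(d < a)%N]ltnNge (leq_trans ca (ltnW cd)) !mulr0n; left; lra.
  case: (ltnP d a) => da; first by rewrite !mulr1n; left; lra.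
  rewrite mulr1n mulr0n (@cum_const m c a) // => [H|b /andP[cb ba]].
    by right; split => //; lra.
  by rewrite zero // cb (leq_trans ba).
have [td|dt] := leP t (m d).
  have sE : s = t by apply/min_idPl.
  apply: (fin (transfer m c d s :: ms1)); rewrite sE subrr in tms1 *.
  split => // [|a an]; last by left.
  by rewrite nrun0 tcatw0; exact: knuth_refl.
(* All of [d] is bumped, so the new row has no letter in []c, d]], and the remaining [t - s] is
   inserted with [d.+1] as the next candidate. *)
have sE : s = m d by apply/min_idPr/ltW.
have [||||ms2 I2] := IHj _ _ (t - s) tms1 _ d.+1.
- by rewrite subr_ge0.
- lia.
- exact: ltnW.
- move=> b /andP[cb]; rewrite ltnS leq_eqVlt /transfer (gtn_eqF cb).
  case/orP => [/eqP->|bd]; first by rewrite eqxx sE subrr.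
  by rewrite (ltn_eqF bd) zero // cb.
exact: fin I2.
Qed.

Lemma insertion s : all (fun r => 0 <= r.2) s ->
  exists ms, tableau_rows ms /\ ev s =~ rows_word ms.
Proof.
elim/last_ind: s => [|s [c t] IH].
  by exists [::]; split => //; rewrite ev_nil; exact: knuth_refl.
rewrite all_rcons => /andP[/= t0 /IH[ms [tms K]]].
rewrite -cats1 ev_cat ev_seq1 /=.
have [cn|nc] := ltnP c n; last by exists ms; rewrite nrun_out // tcatw0.
have [ms' [tms' K' _]] := insert_run tms cn t0.
by exists ms'; split => //; apply: knuth_trans (knuth_catr _ K) K'.
Qed.

(** * From durations of letters to timed tableaux *)

Lemma row_word_val m : (forall a, 0 <= m a) ->
  tlen (row_word m) = cum m n /\
  forall x (a : 'I_n), row_word m x = Some a -> cum m a <= x < cum m a.+1.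
Proof.
move=> m0; rewrite /row_word.
suff : forall k, (k <= n)%N -> tlen (ev (runs m 0 k)) = cum m k /\
    forall x (a : 'I_n), ev (runs m 0 k) x = Some a -> cum m a <= x < cum m a.+1.
  exact.
elim=> [|k IH] kn.
  by rewrite /runs /index_iota /= ev_nil /cum big_geq.
have [lk vk] := IH (ltnW kn).
rewrite runs_recr // ev_cat ev_seq1; split.
  change (tlen (ev (runs m 0 k)) + tlen (nrun k (m k)) = cum m k.+1).
  by rewrite lk tlen_nrun // cumS.
move=> x a /tcat_Some[[_ /vk//]|[kx xa]].
have ka := nrun_letter xa; move: xa; rewrite nrunE lk -ka cumS.
case: ifP => // /andP[x0 xm] _; rewrite lk in kx.
by rewrite kx /= -ltrBlDl.
Qed.

Lemma row_word_row m : timed_row (row_word m).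
Proof.
apply: ev_row; rewrite runs_fst; exact: iota_sorted.
Qed.

(** If at time [x] the lower row shows [a] and the upper one [b <= a], then [x < cum m' b.+1 <= cum
    m b <= cum m a <= x], a contradiction. *)
Lemma row_lt_row_word m m' : (forall a, 0 <= m a) -> (forall a, 0 <= m' a) ->
    (forall a, (a < n)%N -> cum m' a.+1 <= cum m a) ->
  row_lt (row_word m) (row_word m').
Proof.
move=> m0 m'0 H; have [lm vm] := row_word_val m0; have [lm' vm'] := row_word_val m'0.
rewrite /row_lt lm lm'; split=> [|x a b _ /vm/andP[ax xa] /vm'/andP[bx xb]].
  case: n H => [|k] H; first by rewrite /cum !big_geq.
  exact: le_trans (H k (ltnSn k)) (cum_le m0 (leqnSn k)).
rewrite ltnNge; apply/negP => /(cum_le m0) ba.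
by have := H b (ltn_ord b); lra.
Qed.

(** The list stops at the first empty row, since in a tableau all later rows are then empty; a row
    decomposition only admits rows of positive length. *)
Fixpoint nonempty_rows (ms : seq (nat -> R)) : seq (timed_word R n) :=
  if ms is m :: ms' then
    if cum m n == 0 then [::] else rcons (nonempty_rows ms') (row_word m)
  else [::].

Lemma nonempty_rows_tableau ms : tableau_rows ms -> timed_tableau (rows_word ms).
Proof.
move=> tms; exists (nonempty_rows ms).
suff [E [Z [P L]]] : rows_word ms = \big[@tcat R n/tempty]_(u <- nonempty_rows ms) u /\
    (cum (head zero_row ms) n = 0 -> rows_word ms = tempty) /\
    (forall i, (i < size (nonempty_rows ms))%N ->
      timed_row (nth tempty (nonempty_rows ms) i) /\
      0 < tlen (nth tempty (nonempty_rows ms) i)) /\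
    (forall i, (i.+1 < size (nonempty_rows ms))%N ->
      row_lt (nth tempty (nonempty_rows ms) i.+1) (nth tempty (nonempty_rows ms) i)).
  (* Adjacent rows never join into a row: at time [0] the row read first has the strictly larger
     letter. *)
  split => //; split => // i si.
  have [ri li] := P i (ltnW si); have [ri' li'] := P _ si.
  have [len lt] := L i si; move=> r.
  set u := nth tempty (nonempty_rows ms) i in r lt li len.
  set v := nth tempty (nonempty_rows ms) i.+1 in r lt li' len.
  have : isSome (u 0) by rewrite tfun_def lexx.
  have : isSome (v 0) by rewrite tfun_def lexx.
  case v0: (v 0) => [a|//] _; case u0: (u 0) => [b|//] _.
  have := lt 0 a b; rewrite lexx li => /(_ isT v0 u0).
  by rewrite ltnNge (timed_row_catP r u0 v0).
elim: ms tms => [|m ms IH] /=; first by rewrite big_nil.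
move=> [m0 mms tms]; have [E [Z [P L]]] := IH tms.
have [lm _] := row_word_val m0.
have Zm : cum m n = 0 -> tcat (rows_word ms) (row_word m) = tempty.
  move=> mn; rewrite (tlen0 (_ : tlen (row_word m) = 0)) ?lm // tcatw0; apply: Z.
  apply/eqP; rewrite eq_le cum_ge0 => [|c]; last exact: head_ge0.
  rewrite andbT; case: n mms mn => [|k] mms mn; first by rewrite /cum big_geq.
  by apply: le_trans (mms k (ltnSn k)) _; rewrite -mn; apply: cum_le.
case: eqP => [mn|/eqP mn].
  by rewrite Zm // big_nil.
split; first by rewrite -cats1 big_cat big_seq1 -E.
split; first by move/eqP; rewrite (negPf mn).
rewrite size_rcons; split=> i; rewrite ltnS => is0; rewrite !nth_rcons.
  have [si|si] := ltnP i (size (nonempty_rows ms)); first exact: P.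
  have -> : i == size (nonempty_rows ms) by rewrite eqn_leq is0.
  rewrite lm; split; first exact: row_word_row.
  by rewrite lt_neqAle eq_sym mn cum_ge0.
rewrite is0; have [si|si] := ltnP i.+1 (size (nonempty_rows ms)); first exact: L.
have {is0}si : i.+1 = size (nonempty_rows ms) by apply/eqP; rewrite eqn_leq is0.
rewrite -si eqxx.
case: ms {IH E Z P L Zm} mms tms si => //= m' ms mms [m'0 _ _].
case: eqP => // _; rewrite size_rcons => -[->].
by rewrite nth_rcons ltnn eqxx; apply: row_lt_row_word.
Qed.

Lemma tableau_exists w : exists v, knuth_equiv w v /\ timed_tableau v.
Proof.
have [s [ps <-]] := exists_runs w.
have [|ms [tms K]] := @insertion s.
  by apply: sub_all ps => x /ltW.
by exists (rows_word ms); split => //; exact: nonempty_rows_tableau.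
Qed.

End Existence.

Theorem theorem4p3 (R : realType) (n : nat) (w : timed_word R n) :
  exists! v : timed_word R n, knuth_class w v /\ timed_tableau v.
Proof.
have [v [wv tv]] := tableau_exists w; exists v; split=> // v' [wv' tv'].
apply: tableau_uniq => //; apply: rst_trans wv'; exact: rst_sym.
Qed.
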